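(* Let $X$ be an interval of $\mathbb{R}$, let $a\in X$, let $\varphi_1,\dots,\varphi_n$ be measurable real functions on $X$, and let $$\mathcal{A}^\dagger=\{\mu\in\mathcal{H}_a(X)\ :\ \mathbb{E}_\mu[\varphi_i]\le 0,\ 1\le i\le n\}.$$ Let $$\Delta^\dagger(n)=\Big\{\mu\in\mathcal{A}^\dagger\ :\ \mu=\sum_{i=1}^{n+1}\omega_i\mathfrak{u}_i,\ \omega_i\ge 0,\ \mathfrak{u}_i\in\mathcal{U}_a(X)\Big\}.$$ Then for every $\mu\in\mathcal{A}^\dagger$ there exists a probability measure $\boldsymbol{\nu}$ supported on $\Delta^\dagger(n)$ such that $\mu$ is the barycenter of $\boldsymbol{\nu}$.
   Context: A probability measure $\mu$ on the interval $X$, with distribution function $F_\mu(h)=\mu(]-\infty,h])$, is unimodal with mode $a$ if $F_\mu$ is convex on $]-\infty,a[$ and concave on $]a,+\infty[$. $\mathcal{H}_a(X)$ denotes the set of all probability measures on $X$ that are unimodal at $a$. $\mathcal{U}_a(X)$ is the set of uniform probability measures on the intervals $\mathrm{co}(a,z)$ (convex hull of $\{a,z\}$), $z\in X$, including the Dirac mass at $a$ (case $z=a$). The constraint $\mathbb{E}_\mu[\varphi_i]\le 0$ is understood to include that $\varphi_i$ is $\mu$-integrable. The set of Borel probability measures on $X$ carries the weak topology (duality with $C_b(X)$, the bounded continuous real functions on $X$). ''$\mu$ is the barycenter of $\boldsymbol{\nu}$'', with $\boldsymbol\nu$ a probability measure on $\Delta^\dagger(n)$, means $$\int_X\phi\,d\mu=\int_{\Delta^\dagger(n)}\Big(\int_X\phi\,ds\Big)\,d\boldsymbol{\nu}(s)\qquad\text{for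 every }\phi\in C_b(X).$$
   Formalization: U_a(X) is taken with z in the closure of X instead of z in X; for X missing a finite endpoint the literal claim fails, e.g. X=[0,1[, a=0, φ_i=0, μ uniform on [0,1[ (test with φ(x)=x); for closed X nothing changes. *)

(* Defs.v *)
From HB Require Import structures.
From mathcomp Require Import all_boot all_order all_algebra.
From mathcomp Require Import all_classical all_reals all_analysis.

Set Implicit Arguments.
Unset Strict Implicit.
Unset Printing Implicit Defensive.

Import Order.TTheory GRing.Theory Num.Theory.
Import numFieldTopology.Exports numFieldNormedType.Exports.

Local Open Scope classical_set_scope.
Local Open Scope ring_scope.

(* Borel probability measures on a Borel set X of the line, represented by the
   Borel probability measures on the line that give X full mass.
   Pitfall: a MathComp-Analysis measure is a function on all subsets, so two
   terms that agree on every measurable set may differ; no definition below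
   looks at the value of a measure outside the measurable sets. *)
Record prob_on (R : realType) (X : set R) := ProbOn {
  prob_on_measure :> probability (measurableTypeR R) R ;
  prob_on_full : prob_on_measure X = 1%E
}.

HB.instance Definition _ (R : realType) (X : set R) :=
  gen_eqMixin (prob_on X).
HB.instance Definition _ (R : realType) (X : set R) :=
  gen_choiceMixin (prob_on X).

(* C_b(X); the values outside X are irrelevant. *)
Definition Cb (R : realType) (X : set R) : set (R -> R) :=
  [set f : R -> R | {within X, continuous f} /\ [bounded f x | x in X]].

(* The weak topology: the coarsest one that makes mu |-> \int[mu]_(x in X) f x
   continuous for every f in C_b(X). *)
Definition pairing (R : realType) (X : set R) (mu : prob_on X) :
    prod_topology (fun _ : set_type (Cb X) => R) :=
  fun f => (\int[mu]_(x in X) (set_val f : R -> R) x)%R.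

HB.instance Definition _ (R : realType) (X : set R) :=
  Topological.copy (prob_on X) (initial_topology (@pairing R X)).

(* The Borel sigma-algebra of a topological space. The measurable types of the
   library are pointed; the argument t only provides the point. *)
Definition based (T : Type) (t : T) : Type := T.

HB.instance Definition _ (T : topologicalType) (t : T) :=
  Topological.on (based t).
HB.instance Definition _ (T : topologicalType) (t : T) :=
  isPointed.Build (based t) t.

Definition borel (T : topologicalType) (t : T) : Type :=
  g_sigma_algebraType (@open (based t)).

HB.instance Definition _ (T : topologicalType) (t : T) :=
  Measurable.on (borel t).

Definition distribution_function (R : realType)
    (mu : probability (measurableTypeR R) R) (h : R) : R :=
  fine (mu [set` `]-oo, h]]).

Definition unimodal (R : realType) (a : R)
    (mu : probability (measurableTypeR R) R) : Prop :=
  let F := distribution_function mu in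
  @convex_function R R^o [set` `]-oo, a[] F /\
  @convex_function R R^o [set` `]a, +oo[] (\- F).

(* U_a(X): the probability measures on X that are uniform on an interval
   co(a, z). When X is closed this is the usual "z in X". A finite endpoint z
   missing from X has to be allowed as well, since the uniform measure on
   co(a, z) still lives on X: the uniform measure on [0, 1[ is unimodal at 0 on
   X = [0, 1[, has mean 1/2, and so is not a mixture of uniform measures on
   [0, z] with z < 1. *)
Definition uniform_at (R : realType) (X : set R) (a : R) : set (prob_on X) :=
  [set u : prob_on X | exists2 z : R, closure X z &
    [\/ z = a /\ (forall A, measurable A -> u A = \d_a A),
        exists az : a < z, forall A, measurable A -> u A = uniform_prob az A
      | exists za : z < a, forall A, measurable A -> u A = uniform_prob za A]].

Definition admissible (R : realType) (X : set R) (a : R) (n : nat)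
    (phi : 'I_n -> R -> R) : set (prob_on X) :=
  [set mu : prob_on X | unimodal a mu /\
    forall i : 'I_n, mu.-integrable X (EFin \o phi i) /\
                     (\int[mu]_(x in X) (phi i x)%:E <= 0)%E].

Definition Delta (R : realType) (X : set R) (a : R) (n : nat)
    (phi : 'I_n -> R -> R) : set (prob_on X) :=
  [set mu : prob_on X | admissible a phi mu /\
    exists (w : 'I_n.+1 -> R) (u : 'I_n.+1 -> prob_on X),
      [/\ forall i, 0 <= w i, forall i, uniform_at a (u i) &
          forall A, measurable A -> mu A = (\sum_(i < n.+1) (w i)%:E * u i A)%E]].

Definition is_barycenter (R : realType) (X : set R) (D : set (prob_on X))
    (s0 : set_type D) (nu : probability (borel s0) R) (mu : prob_on X) : Prop :=
  forall f : R -> R, Cb X f ->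
    (\int[mu]_(x in X) (f x)%:E =
     \int[nu]_s \int[(set_val s : prob_on X)]_(x in X) (f x)%:E)%E.

(* Main.v *)
Require Import Defs.
From HB Require Import structures.
From mathcomp Require Import all_boot all_order all_algebra.
From mathcomp Require Import all_classical all_reals all_analysis.
From mathcomp Require Import measurable_realfun ring lra.

Set Implicit Arguments.
Unset Strict Implicit.
Unset Printing Implicit Defensive.

Import Order.TTheory GRing.Theory Num.Theory.
Import numFieldTopology.Exports numFieldNormedType.Exports.

Local Open Scope classical_set_scope.
Local Open Scope ring_scope.

(** Khinchine's theorem writes a unimodal [mu] as a mixture of uniform measures
    on segments [co(a, z)], the endpoint [z] having some law [P]: on each side
    of [a] the density of [mu] is monotone, and slicing the region below its
    graph horizontally gives the segments. The constraints on [mu] become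
    [n] moment constraints on [P], so it remains to write [P] as a mixture of
    measures with at most [n + 1] atoms that satisfy the same constraints.
    - One constraint at a time: if the constraint function [g] satisfies
      [\int g <= 0], take a point [x] with [g x <= 0] and an independent point
      [y] with [g y > 0], and give them masses proportional to [g^+ y] and
      [g^- x]. This doubles the number of atoms.
    - Caratheodory's reduction, done measurably in the parameter, then brings
      the number of atoms down to [n + 1].
    Weights are kept unnormalised until the very end. *)

(** * Integration and measurability *)

(** [X] may fail to be compact and the [phi i] may be unbounded and discontinuous, so nothing rests
    on extreme points or limits of measures: each mixture is an explicit image of a measure on a
    parameter space. Its identity is tested on nonnegative measurable functions with values in the
    extended reals, where Tonelli asks for no integrability; signed integrands are split into
    positive and negative parts only when a constraint or a function of $C_b(X)$ is read off. The
    bound $n+1$ comes from linear algebra: total mass and $n$ moments are $n+1$ linear conditions,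
    so more than $n+1$ atoms carry a nonzero signed relation. Which atom disappears depends on the
    parameter, and ties occur; the cases are finite in number and carry measurable weights, whence
    the finite index [I] next to the parameter [t]. Normalisation has to wait, because the pairing
    leaves some parameters with no mass at all. The last obstacle is the $\sigma$-algebra: the map
    from parameters to measures must be measurable for the Borel sets of the weak topology. *)

Lemma ge0_integral_mrestr d (T : measurableType d) (R : realType)
    (m : {measure set T -> \bar R}) (D : set T) (mD : measurable D)
    (f : T -> \bar R) :
  measurable_fun setT f -> (forall x, 0 <= f x)%E ->
  (\int[mrestr m mD]_x f x = \int[m]_(x in D) f x)%E.
Proof.
move=> mf f0.
have mDC : measurable (~` D) by exact: measurableC.
rewrite -(setUv D) ge0_integral_setU//=; first last.
- by apply/disj_setPS => x [].
- exact: measurable_funTS.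
rewrite [X in (X + _)%E](eq_measure_integral m); last first.
  by move=> A mA AD; rewrite /= /mrestr setIidl.
rewrite [X in (_ + X)%E](eq_measure_integral mzero); last first.
  move=> A mA AD; rewrite /= /mrestr (_ : A `&` D = set0) ?measure0//.
  by apply/seteqP; split=> // x [/AD].
by rewrite integral_measure_zero adde0.
Qed.

Lemma pushforward_measureP d d' (T : measurableType d) (T' : measurableType d')
    (R : realType) (m : {measure set T -> \bar R}) (f : T -> T') :
  measurable_fun setT f ->
  exists2 m' : {measure set T' -> \bar R}, forall A, m' A = m (f @^-1` A) &
    forall h : T' -> \bar R, measurable_fun setT h -> (forall x, 0 <= h x)%E ->
      (\int[m']_y h y = \int[m]_x h (f x))%E.
Proof.
move=> mf; pose mm := isMeasurableFun.Build _ _ _ _ f mf.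
pose g : {mfun T >-> T'} := HB.pack f mm.
have [m' m'E] : exists m' : {measure set T' -> \bar R},
    m' = pushforward m g :> (set T' -> \bar R).
  by unshelve eexists (pushforward m g); first exact: mf.
exists m' => [A|h mh h0]; first by rewrite m'E.
by rewrite m'E ge0_integral_pushforward.
Qed.

(** The density [w] is realised geometrically: on the region [E] under the graph of [w], the fibre
    over [t] has length [w t], so projecting the restricted product measure to [T] and applying [G]
    gives a measure with no separate proof of additivity. *)
Lemma weighted_pushforward1 d d' (T : measurableType d) (T' : measurableType d')
    (R : realType) (Q : {sigma_finite_measure set T -> \bar R})
    (w : T -> R) (G : T -> T') :
  measurable_fun setT w -> (forall t, 0 <= w t) -> measurable_fun setT G ->
  exists m : {measure set T' -> \bar R}, forall h : T' -> \bar R,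
    measurable_fun setT h -> (forall x, 0 <= h x)%E ->
    (\int[m]_x h x = \int[Q]_t ((w t)%:E * h (G t)))%E.
Proof.
move=> mw w0 mG.
pose E := [set ty : T * measurableTypeR R | 0 <= ty.2 < w ty.1].
have mE : measurable E.
  have -> : E = (fun ty => (0 <= ty.2) && (ty.2 < w ty.1)) @^-1` [set true].
    by apply/seteqP; split => x.
  rewrite -[X in measurable X]setTI.
  apply: measurable_and => //.
    by apply: measurable_fun_ler => //; exact: measurable_snd.
  apply: measurable_fun_ltr; first exact: measurable_snd.
  by apply: measurableT_comp => //; exact: measurable_fst.
have mGf : measurable_fun setT (fun ty : T * measurableTypeR R => G ty.1).
  by apply: measurableT_comp => //; exact: measurable_fst.
pose M : {measure set (T * measurableTypeR R) -> \bar R} :=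
  mrestr (Q \x (@lebesgue_measure R))%E mE.
have [m _ mI] := pushforward_measureP M mGf.
exists m => h mh h0; rewrite mI//.
have mhG : measurable_fun setT (fun ty : T * measurableTypeR R => h (G ty.1)).
  exact: (measurableT_comp mh mGf).
rewrite ge0_integral_mrestr//.
rewrite integral_mkcond fubini_tonelli1//; last 2 first.
- by apply/(measurable_restrictT _ mE)/measurable_funTS.
- by move=> x; rewrite patchE; case: ifP.
apply: eq_integral => t _; rewrite /fubini_F.
transitivity (\int[lebesgue_measure]_(y in `[0%R, w t[) h (G t))%E.
  rewrite [RHS]integral_mkcond; apply: eq_integral => y _.
  by rewrite !patchE /= /E; congr (if _ then _ else _); rewrite !in_setE.
rewrite integral_cst//= lebesgue_measure_itv/= lte_fin muleC.
case: ltP => [_|wt0]; first by rewrite oppr0 addr0.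
by have -> : w t = 0 by apply/le_anti; rewrite wt0 w0.
Qed.

Lemma weighted_pushforward d d' (T : measurableType d) (T' : measurableType d')
    (R : realType) (Q : {sigma_finite_measure set T -> \bar R}) (I : finType)
    (w : I -> T -> R) (G : I -> T -> T') :
  (forall i, measurable_fun setT (w i)) -> (forall i t, 0 <= w i t) ->
  (forall i, measurable_fun setT (G i)) ->
  exists m : {measure set T' -> \bar R}, forall h : T' -> \bar R,
    measurable_fun setT h -> (forall x, 0 <= h x)%E ->
    (\int[m]_x h x = \sum_(i : I) \int[Q]_t ((w i t)%:E * h (G i t)))%E.
Proof.
move=> mw w0 mG; elim: (index_enum I) => [|i s [m mE]].
  by exists mzero => h mh h0; rewrite big_nil integral_measure_zero.
have [m' m'E] := weighted_pushforward1 Q (mw i) (w0 i) (mG i).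
exists (measure_add m' m) => h mh h0.
by rewrite big_cons ge0_integral_measure_add// mE// m'E.
Qed.

(** The second marginal of the product measure restricted to [E]. In the layer decomposition below,
    [t] is a level and the section is the set where a density exceeds that level. *)
Lemma section_measure d d' (T : measurableType d) (T' : measurableType d')
    (R : realType) (Q : {sigma_finite_measure set T -> \bar R})
    (Q' : {sigma_finite_measure set T' -> \bar R}) (E : set (T * T')) :
  measurable E ->
  exists m : {measure set T' -> \bar R}, forall h : T' -> \bar R,
    measurable_fun setT h -> (forall x, 0 <= h x)%E ->
    (\int[m]_x h x = \int[Q]_t \int[Q']_(x in xsection E t) h x)%E.
Proof.
move=> mE; pose M : {measure set (T * T') -> \bar R} := mrestr (Q \x Q')%E mE.
have msnd : measurable_fun setT (@snd T T') by exact: measurable_snd.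
have [m _ mI] := pushforward_measureP M msnd.
exists m => h mh h0; rewrite mI//.
have mhG : measurable_fun setT (fun x : T * T' => h x.2).
  exact: (measurableT_comp mh msnd).
rewrite ge0_integral_mrestr//.
rewrite integral_mkcond fubini_tonelli1//; last 2 first.
- by apply/(measurable_restrictT _ mE)/measurable_funTS.
- by move=> x; rewrite patchE; case: ifP.
apply: eq_integral => t _; rewrite /fubini_F [RHS]integral_mkcond.
by apply: eq_integral => y _; rewrite !patchE mem_xsection.
Qed.

Lemma measurable_fun_invr d (T : measurableType d) (R : realType) (f : T -> R) :
  measurable_fun setT f -> measurable_fun setT (fun x => (f x)^-1).
Proof.
move=> mf.
(* Squaring gives a nonnegative base, on which [powR] with exponent $-1$ is the inverse; at a zero
   of [f] both sides are 0. *)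
have -> : (fun x => (f x)^-1) = (fun x => f x * ((f x ^+ 2) `^ (- 1))).
  apply/funext => x; rewrite powR_inv1 ?sqr_ge0//.
  have [->|fx0] := eqVneq (f x) 0; first by rewrite invr0 mul0r.
  by rewrite expr2 invfM mulrA divff// mul1r.
apply: measurable_funM => //.
apply: (@measurableT_comp _ _ _ _ _ _ (fun y => y `^ (-1))).
  exact: measurable_powR.
exact: measurable_funX.
Qed.

Lemma measurable_fun_bool_set d (T : measurableType d) (b : T -> bool) :
  measurable_fun setT b -> measurable [set t | b t].
Proof.
move=> mb; rewrite -[X in measurable X]setTI.
by have := mb measurableT [set true] I; rewrite (_ : _ @^-1` _ = [set t | b t]).
Qed.

Lemma measurable_fun_in_set d (T : measurableType d) (A : set T) :
  measurable A -> measurable_fun setT (fun t => t \in A).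
Proof.
move=> mA; apply: (measurable_fun_bool true); rewrite setTI.
rewrite (_ : _ @^-1` _ = A)//.
by apply/seteqP; split => t /= => [/set_mem|/mem_set].
Qed.

(** [S] is open for the topology that the finitely many functions [p k] induce on [T], hence a union
    of boxes with rational centre and radius $1/(m+1)$, of which there are countably many. *)
Lemma measurable_of_box d (T : measurableType d) (R : realType) (K : finType)
    (p : K -> T -> R) (S : set T) :
  (forall k, measurable_fun setT (p k)) ->
  (forall t, S t -> exists2 e, 0 < e &
    forall t', (forall k, `|p k t' - p k t| < e) -> S t') ->
  measurable S.
Proof.
move=> mp Sbox.
pose B (q : {ffun K -> rat} * nat) :=
  [set t | [forall k, `|p k t - ratr (q.1 k)| < q.2.+1%:R^-1]].
have mB q : measurable (B q).
  have -> : B q = \bigcap_(k in [set: K])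
      [set t | `|p k t - ratr (q.1 k)| < q.2.+1%:R^-1].
    apply/seteqP; split => t /=; first by move/forallP => h k _; exact: h.
    by move=> h; apply/forallP => k; exact: h.
  apply: fin_bigcap_measurable => // k _.
  apply: measurable_fun_bool_set; apply: measurable_fun_ltr => //.
  by apply: measurableT_comp => //; exact: measurable_funB.
have -> : S = \bigcup_(q in [set q | B q `<=` S]) B q.
  apply/seteqP; split => [t St|t [q /= qS /qS]//].
  have [e e0 eS] := Sbox t St.
  (* A radius below [e / 2] makes a box that contains [t] lie in the box of radius [e] around [t],
     although its centre is only a rational approximation. *)
  pose n := Num.truncn (2 / e).
  have ne : n.+1%:R^-1 < e / 2.
    rewrite invf_plt ?posrE ?divr_gt0//.
    by rewrite invf_div; have := truncnS_gt (2 / e).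
  have qe k : exists q : rat, `|p k t - ratr q| < n.+1%:R^-1.
    have : p k t - n.+1%:R^-1 < p k t + n.+1%:R^-1.
      by rewrite ltrD2l gtrN// invr_gt0.
    move=> /rat_in_itvoo[q]; rewrite in_itv/= => /andP[q1 q2].
    exists q; rewrite distrC ltr_distl q2 andbT.
    by rewrite q1.
  have [f fE] := choice qe.
  exists ([ffun k => f k], n); last first.
    by apply/forallP => k /=; rewrite ffunE.
  move=> t' /forallP /= Bt'; apply: eS => k.
  have := Bt' k; rewrite ffunE => h1; have h2 := fE k.
  have -> : p k t' - p k t = (p k t' - ratr (f k)) - (p k t - ratr (f k)) by lra.
  rewrite (le_lt_trans (ler_normB _ _))// [ltRHS](splitr e).
  by rewrite ltrD// (lt_trans _ ne).
pose F q := if `[< B q `<=` S >] then B q else set0.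
have -> : \bigcup_(q in [set q | B q `<=` S]) B q = \bigcup_q F q.
  apply/seteqP; split => t [q /= qS Bt].
    by exists q => //; rewrite /F asboolT.
  by move: Bt; rewrite /F; case: asboolP => // h Bt; exists q.
apply: countable_bigcupT_measurable; first exact: countableP.
by move=> q; rewrite /F; case: ifP.
Qed.

(** At each [t] the first [i] in the enumeration with [V i t] is used. The same [i] serves every
    [k], so a whole vector is chosen coherently. *)
Lemma measurable_glue d (T : measurableType d) (R : realType) (I : finType)
    (K : Type) (V : I -> set T) (f : I -> K -> T -> R) :
  (forall i, measurable (V i)) -> (forall i k, measurable_fun setT (f i k)) ->
  exists g : K -> T -> R, (forall k, measurable_fun setT (g k)) /\
    forall t, (exists i, V i t) -> exists2 i, V i t & forall k, g k t = f i k t.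
Proof.
move=> mV mf.
suff [g [mg gE]] : exists g : K -> T -> R, (forall k, measurable_fun setT (g k)) /\
    forall t, (exists2 i, i \in enum I & V i t) ->
      exists2 i, V i t & forall k, g k t = f i k t.
  by exists g; split => // t [i Vit]; apply: gE; exists i; rewrite ?mem_enum.
elim: (enum I) => [|i s [g [mg gE]]].
  by exists (fun _ _ => 0); split => // t [].
exists (fun k t => if t \in V i then f i k t else g k t); split.
  by move=> k; apply: measurable_fun_ifT => //; exact: measurable_fun_in_set.
move=> t [j]; rewrite inE; case: (boolP (t \in V i)) => [/set_mem Vi _ _|Vi].
  by exists i.
case/predU1P => [->|js] Vj; last by apply: gE; exists j.
by move: Vi; rewrite notin_setE.
Qed.

(** Fewer equations than unknowns always leave a nonzero solution. Gaussian elimination finds it by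
    finitely many case distinctions on measurable sets, so the solution can be taken measurable in
    [t]. *)
Lemma measurable_kernel d (T : measurableType d) (R : realType) (k m : nat)
    (v : 'I_k -> 'I_m.+1 -> T -> R) :
  (k <= m)%N -> (forall i j, measurable_fun setT (v i j)) ->
  exists c : 'I_m.+1 -> T -> R, (forall j, measurable_fun setT (c j)) /\
    forall t, (exists j, c j t != 0) /\ forall i, \sum_j c j t * v i j t = 0.
Proof.
elim: k m v => [|k IH] m v km mv.
  exists (fun _ _ => 1); split => // t; split; first by exists ord0; exact: oner_neq0.
  by case.
case: m => // m in v km mv *.
(* This solution serves where the first row vanishes and only the other [k] equations count. *)
have [c0 [mc0 c0E]] := IH _ (fun i j => v (lift ord0 i) j) (ltnW km)
  (fun i j => mv _ _).
(* Elimination of unknown [j] with pivot [v ord0 j t], cleared of denominators. The solution [c1 j]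
   of the reduced system is therefore multiplied by the pivot in [f], and coordinate [j] is read off
   the first row. *)
pose v' j (i : 'I_k) (l : 'I_m.+1) t := v ord0 j t * v (lift ord0 i) (lift j l) t
  - v ord0 (lift j l) t * v (lift ord0 i) j t.
have mv' j i l : measurable_fun setT (v' j i l).
  by apply: measurable_funB; exact: measurable_funM.
have [c1 c1P] := choice (fun j => IH m (v' j) km (mv' j)).
have mc1 j := (c1P j).1; have c1E j := (c1P j).2.
(* [Some j] stands for a nonzero pivot in column [j], [None] for a first row that is zero. *)
pose f (o : option 'I_m.+2) (l : 'I_m.+2) t :=
  if o is Some j then
    if unlift j l is Some l' then c1 j l' t * v ord0 j t
    else - \sum_l' c1 j l' t * v ord0 (lift j l') t
  else c0 l t.
pose V (o : option 'I_m.+2) := if o is Some j then [set t | v ord0 j t != 0]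
  else [set t | [forall j, v ord0 j t == 0]].
have [||c [mc cE]] := @measurable_glue _ T R _ _ V f.
- case=> [j|] /=.
    apply: measurable_fun_bool_set; apply: measurable_neg.
    exact: measurable_fun_eqr.
  have -> : [set t | [forall j, v ord0 j t == 0]] = \bigcap_(j in [set: 'I_m.+2])
      [set t | v ord0 j t == 0].
    apply/seteqP; split => t /=; first by move/forallP => h j _; exact: h.
    by move=> h; apply/forallP => j; exact: h.
  apply: fin_bigcap_measurable => // j _.
  apply: measurable_fun_bool_set; exact: measurable_fun_eqr.
- case=> [j|] l; rewrite /f//; case: (unliftP j l) => [l' _|_]; first exact: measurable_funM.
  apply: measurable_funN; apply: measurable_sum => l'; exact: measurable_funM.
have f_lift j l t : f (Some j) (lift j l) t = c1 j l t * v ord0 j t.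
  rewrite /f; case: (unliftP j (lift j l)) => [l' /lift_inj <-//|/eqP].
  by rewrite eq_sym (negbTE (neq_lift _ _)).
have f_pivot j t : f (Some j) j t = - \sum_l c1 j l t * v ord0 (lift j l) t.
  by rewrite /f; case: (unliftP j j) => // l /eqP; rewrite (negbTE (neq_lift _ _)).
have f_none l t : f None l t = c0 l t by [].
clearbody f; exists c; split => // t.
have [|o Vt ct] := cE t.
  have [/forallP h|] := boolP [forall j, v ord0 j t == 0].
    by exists None; apply/forallP.
  by rewrite negb_forall => /existsP[j vj]; exists (Some j).
under [X in _ /\ X]eq_forall => i do under eq_bigr => j _ do rewrite ct.
under [X in X /\ _]eq_exists => j do rewrite ct.
case: o Vt {ct} => [j|] /=.
- move=> v0; have [[l cl] cv] := c1E j t; split.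
    by exists (lift j l); rewrite f_lift mulf_neq0.
  move=> i; rewrite (bigD1 j)//= f_pivot.
  have -> : \sum_(l < m.+2 | l != j) f (Some j) l t * v i l t =
      \sum_(l < m.+1) f (Some j) (lift j l) t * v i (lift j l) t.
    rewrite (reindex_onto (lift j) (fun l => odflt ord0 (unlift j l)))/=; last first.
      by move=> l'; case: (unliftP j l') => [l'' ->//|->]; rewrite eqxx.
    apply: eq_bigl => l'; rewrite eq_sym neq_lift/=.
    case: (unliftP j (lift j l')) => [l'' /lift_inj ->/=|/eqP]; first by rewrite eqxx.
    by rewrite eq_sym (negbTE (neq_lift _ _)).
  under [X in _ + X]eq_bigr => l' _ do rewrite f_lift.
  rewrite mulNr mulr_suml addrC -sumrB.
  case: (unliftP ord0 i) => [i' ->|->]; last first.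
    by rewrite big1// => l' _; rewrite mulrAC subrr.
  rewrite -[RHS](cv i'); apply: eq_bigr => l' _; rewrite /v'.
  by rewrite mulrBr !mulrA.
- move=> /forallP v0; split.
    by have [[l cl] _] := c0E t; exists l; rewrite f_none.
  move=> i; under eq_bigr => l _ do rewrite f_none.
  case: (unliftP ord0 i) => [i' ->|->].
    by have [_] := c0E t.
  by rewrite big1// => j _; rewrite (eqP (v0 j)) mulr0.
Qed.

(** * Mixtures of finitely many atoms under moment constraints *)

Lemma measurable_fun_forall d (T : measurableType d) (I : finType)
    (b : I -> T -> bool) :
  (forall i, measurable_fun setT (b i)) ->
  measurable_fun setT (fun t => [forall i, b i t]).
Proof.
move=> mb; apply: (measurable_fun_bool true); rewrite setTI.
have -> : (fun t => [forall i, b i t]) @^-1` [set true] =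
    \bigcap_(i in [set: I]) [set t | b i t].
  apply/seteqP; split => t /=; first by move/forallP => h i _; exact: h.
  by move=> h; apply/forallP => i; exact: h.
apply: fin_bigcap_measurable => // i _; exact: measurable_fun_bool_set.
Qed.

Definition configuration d (T : measurableType d) d' (Z : measurableType d')
    (R : realType) (N : nat) (w : 'I_N -> T -> R) (z : 'I_N -> T -> Z) : Prop :=
  [/\ forall j, measurable_fun setT (w j), forall j t, 0 <= w j t &
      forall j, measurable_fun setT (z j)].

(** The integral of [h] against the finite measure $\sum_j w_j(t)\,\delta_{z_j(t)}$. *)
Definition atoms_integral d (T : measurableType d) d' (Z : measurableType d')
    (R : realType) (N : nat) (w : 'I_N -> T -> R) (z : 'I_N -> T -> Z)
    (h : Z -> \bar R) (t : T) : \bar R :=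
  (\sum_j (w j t)%:E * h (z j t))%E.

Lemma measurable_atoms_integral d (T : measurableType d) d'
    (Z : measurableType d') (R : realType) (N : nat)
    (w : 'I_N -> T -> R) (z : 'I_N -> T -> Z) (h : Z -> \bar R) :
  configuration w z -> measurable_fun setT h ->
  measurable_fun setT (atoms_integral w z h).
Proof.
move=> [mw _ mz] mh; apply: emeasurable_sum => j.
apply: emeasurable_funM; first exact/measurable_EFinP.
exact: measurableT_comp.
Qed.

Lemma atoms_integral_ge0 d (T : measurableType d) d'
    (Z : measurableType d') (R : realType) (N : nat)
    (w : 'I_N -> T -> R) (z : 'I_N -> T -> Z) (h : Z -> \bar R) (t : T) :
  configuration w z -> (forall x, 0 <= h x)%E -> (0 <= atoms_integral w z h t)%E.
Proof.
move=> [_ w0 _] h0; apply: sume_ge0 => j _.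
by rewrite mule_ge0// lee_fin.
Qed.

(** * Caratheodory's reduction, measurable in the parameter *)

Section caratheodory.
Context d (T : measurableType d) d' (Z : measurableType d') (R : realType).

(* A signed relation [c] between N + 1 atoms with vanishing total mass and
   vanishing moments moves the weights both ways, until one of them is zero. *)
Lemma caratheodory_step (n N : nat) (psi : 'I_n -> Z -> R)
    (w : 'I_N.+1 -> T -> R) (z : 'I_N.+1 -> T -> Z) :
  (n < N)%N -> (forall i, measurable_fun setT (psi i)) -> configuration w z ->
  (forall i t, \sum_j w j t * psi i (z j t) <= 0) ->
  exists (I : finType) (w' : I -> 'I_N -> T -> R) (z' : I -> 'I_N -> T -> Z),
    [/\ forall p, configuration (w' p) (z' p),
        forall p i t, \sum_j w' p j t * psi i (z' p j t) <= 0 &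
        forall h : Z -> \bar R, (forall x, 0 <= h x)%E -> forall t,
          (\sum_p atoms_integral (w' p) (z' p) h t = atoms_integral w z h t)%E].
Proof.
move=> nN mpsi [mw w0 mz] wpsi.
(* Row 0, constantly 1, encodes total mass; the other rows are the [n] moments. Together they are
   [n + 1] equations in [N + 1] unknowns. *)
pose v (i : 'I_n.+1) j t := if unlift ord0 i is Some i' then psi i' (z j t) else 1.
have mv i j : measurable_fun setT (v i j).
  rewrite /v; case: (unliftP ord0 i) => [i' _|_]; last exact: measurable_cst.
  exact: measurableT_comp.
have [c [mc cP]] := measurable_kernel nN mv.
have sum_c t : \sum_j c j t = 0.
  have [_ /(_ ord0)] := cP t; rewrite /v; case: (unliftP ord0 ord0) => [i /eqP|_ h].
    by rewrite (negbTE (neq_lift _ _)).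
  by rewrite -[RHS]h; apply: eq_bigr => j _; rewrite mulr1.
have sum_cpsi i t : \sum_j c j t * psi i (z j t) = 0.
  have [_ /(_ (lift ord0 i))] := cP t; rewrite /v.
  by case: (unliftP ord0 (lift ord0 i)) => [i' /lift_inj <-|/eqP//].
(* A pair records which weight vanishes first in each direction: along [c] the one with [c < 0] and
   least ratio of [w] to [- c], along [- c] the one with [c > 0] and least ratio of [w] to [c]. *)
pose q := ('I_N.+1 * 'I_N.+1)%type.
pose b (p : q) t := [&& c p.1 t < 0, 0 < c p.2 t,
  [forall l, (c l t < 0) ==> (w p.1 t / (- c p.1 t) <= w l t / (- c l t))] &
  [forall l, (0 < c l t) ==> (w p.2 t / c p.2 t <= w l t / c l t)]].
have mdiv l : measurable_fun setT (fun t => w l t / c l t).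
  by apply: measurable_funM => //; exact: measurable_fun_invr.
have mdivN l : measurable_fun setT (fun t => w l t / - c l t).
  apply: measurable_funM => //; apply: measurable_fun_invr.
  exact: measurable_funN.
have mb p : measurable_fun setT (b p).
  apply: measurable_and; first exact: measurable_fun_ltr.
  apply: measurable_and; first exact: measurable_fun_ltr.
  apply: measurable_and; apply: measurable_fun_forall => l;
    under eq_fun do rewrite implybE; apply: measurable_or;
    do ?[apply: measurable_neg]; do ?[exact: measurable_fun_ltr];
    exact: measurable_fun_ler.
have b_ex t : exists p, b p t.
  have [[j cj] _] := cP t.
  have [i0 ci0] : exists i0, c i0 t < 0.
    apply/existsP; apply: contraT; rewrite negb_exists => /forallP h.
    have c_ge0 l : true -> 0 <= c l t by rewrite leNgt.
    by move: cj; rewrite (psumr_eq0P c_ge0 (sum_c t))// eqxx.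
  have [j0 cj0] : exists j0, 0 < c j0 t.
    apply/existsP; apply: contraT; rewrite negb_exists => /forallP h.
    have c_ge0 l : true -> 0 <= - c l t by rewrite oppr_ge0 leNgt.
    have sN : \sum_l - c l t = 0 by rewrite sumrN sum_c oppr0.
    by move: cj; rewrite -oppr_eq0 (psumr_eq0P c_ge0 sN)// eqxx.
  case: (arg_minP (fun l => w l t / - c l t) (P := fun l => c l t < 0) ci0).
  move=> i ci iP.
  case: (arg_minP (fun l => w l t / c l t) (P := fun l => 0 < c l t) cj0).
  move=> j' cj' jP.
  exists (i, j'); rewrite /b/= ci cj'/=; apply/andP; split; apply/forallP => l.
    by apply/implyP; exact: iP.
  by apply/implyP; exact: jP.
(* Several pairs can attain the minima at the same [t]. Instead of selecting one, [e] spreads the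
   mass evenly over all of them, a measurable partition of unity. *)
pose bR p t : R := if b p t then 1 else 0.
have mbR p : measurable_fun setT (bR p).
  by apply: measurable_fun_ifT => //; exact: measurable_cst.
have bR0 p t : 0 <= bR p t by rewrite /bR; case: ifP.
pose e p t := bR p t / \sum_p bR p t.
have me p : measurable_fun setT (e p).
  apply: measurable_funM => //; apply: measurable_fun_invr.
  exact: measurable_sum.
have e0 p t : 0 <= e p t by rewrite divr_ge0// sumr_ge0.
have sum_e t : \sum_p e p t = 1.
  rewrite -mulr_suml divff// gt_eqF//.
  have [p bp] := b_ex t; rewrite (bigD1 p)//= ltr_wpDr ?sumr_ge0//.
  by rewrite /bR bp.
have e_b p t : ~~ b p t -> e p t = 0.
  by rewrite /e /bR => /negbTE ->; rewrite mul0r.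
(* The point [w] lies on the segment from [w + al c] to [w - be c]; writing it as their mixture
   requires [th al = (1 - th) be]. If [al] and [be] are both 0, division by zero gives [th = 0], and
   both endpoints equal [w]. *)
pose al (p : q) t := w p.1 t / - c p.1 t.
pose be (p : q) t := w p.2 t / c p.2 t.
pose th p t := be p t / (al p t + be p t).
have mal p : measurable_fun setT (al p) by exact: mdivN.
have mbe p : measurable_fun setT (be p) by exact: mdiv.
have mth p : measurable_fun setT (th p).
  apply: measurable_funM => //; apply: measurable_fun_invr.
  exact: measurable_funD.
pose W (p : q * bool) l t := if p.2 then e p.1 t * (th p.1 t * (w l t + al p.1 t * c l t))
  else e p.1 t * ((1 - th p.1 t) * (w l t - be p.1 t * c l t)).
(* The atom whose weight [W p] is zero; [lift (r p)] later skips it. *)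
pose r (p : q * bool) := if p.2 then p.1.1 else p.1.2.
have mW p l : measurable_fun setT (W p l).
  case: p => p [] /=; rewrite /W /=; apply: measurable_funM => //;
    apply: measurable_funM => //.
  - by apply: measurable_funD => //; exact: measurable_funM.
  - by apply: measurable_funB => //; exact: measurable_cst.
  - by apply: measurable_funB => //; exact: measurable_funM.
have W0 p l t : 0 <= W p l t.
  have [bt|/e_b et] := boolP (b p.1 t); last first.
    by rewrite /W et !mul0r; case: ifP.
  move: (bt) => /and4P[c1 c2 /forallP h1 /forallP h2].
  have al0 : 0 <= al p.1 t by rewrite divr_ge0// oppr_ge0 ltW.
  have be0 : 0 <= be p.1 t by rewrite divr_ge0// ltW.
  have th0 : 0 <= th p.1 t by rewrite divr_ge0// addr_ge0.
  have th1 : th p.1 t <= 1.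
    have [s0|s0] := eqVneq (al p.1 t + be p.1 t) 0.
      by rewrite /th s0 invr0 mulr0.
    by rewrite ler_pdivrMr ?mul1r ?lerDr// lt_neqAle eq_sym s0 addr_ge0.
  rewrite /W; case: ifP => _; rewrite mulr_ge0// mulr_ge0 ?subr_ge0//.
    have [cl|cl] := ltP (c l t) 0; last by rewrite addr_ge0// mulr_ge0.
    have := implyP (h1 l) cl; rewrite -/(al p.1 t) ler_pdivlMr ?oppr_gt0//.
    by rewrite mulrN => h; lra.
  have [cl|cl] := ltP 0 (c l t); last first.
    by rewrite (le_trans _ (w0 l t))// mulr_ge0_le0.
  by have := implyP (h2 l) cl; rewrite -/(be p.1 t) ler_pdivlMr.
have Wr p t : W p (r p) t = 0.
  have [bt|/e_b et] := boolP (b p.1 t); last first.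
    by rewrite /W et !mul0r; case: ifP.
  move: (bt) => /and4P[c1 c2 _ _].
  have wal : w p.1.1 t + al p.1 t * c p.1.1 t = 0 by rewrite /al; field; rewrite lt_eqF.
  have wbe : w p.1.2 t - be p.1 t * c p.1.2 t = 0 by rewrite /be; field; rewrite gt_eqF.
  by case: p {bt c1 c2} wal wbe => p [] /= wal wbe; rewrite /W /r/= ?wal ?wbe !mulr0.
have sumW l t : \sum_p W p l t = w l t.
  rewrite -(pair_bigA _ (fun p c => W (p, c) l t))/=.
  transitivity (\sum_p e p t * w l t); last by rewrite -mulr_suml sum_e mul1r.
  apply: eq_bigr => p _; rewrite big_bool /W /= -mulrDr.
  have [bt|/e_b ->] := boolP (b p t); last by rewrite !mul0r.
  congr (_ * _).
  suff : th p t * al p t = (1 - th p t) * be p t.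
    move=> h; transitivity (w l t + (th p t * al p t - (1 - th p t) * be p t) * c l t).
      by ring.
    by rewrite h subrr mul0r addr0.
  rewrite /th; have [s0|s0] := eqVneq (al p t + be p t) 0; last by field.
  move: (bt) => /and4P[c1 c2 _ _].
  have al0 : 0 <= al p t by rewrite divr_ge0// oppr_ge0 ltW.
  have be0 : 0 <= be p t by rewrite divr_ge0// ltW.
  have -> : be p t = 0 by lra.
  by rewrite !mul0r mulr0.
have Wpsi p i t : \sum_l W p l t * psi i (z l t) <= 0.
  have [bt|/e_b et] := boolP (b p.1 t); last first.
    by rewrite big1// => l _; rewrite /W et; case: ifP; rewrite !mul0r.
  move: (bt) => /and4P[c1 c2 _ _].
  have al0 : 0 <= al p.1 t by rewrite divr_ge0// oppr_ge0 ltW.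
  have be0 : 0 <= be p.1 t by rewrite divr_ge0// ltW.
  have th0 : 0 <= th p.1 t by rewrite divr_ge0// addr_ge0.
  have th1 : th p.1 t <= 1.
    have [s0|s0] := eqVneq (al p.1 t + be p.1 t) 0.
      by rewrite /th s0 invr0 mulr0.
    by rewrite ler_pdivrMr ?mul1r ?lerDr// lt_neqAle eq_sym s0 addr_ge0.
  (* The moments of [c] vanish, so moving along [c] changes no constraint sum; only the nonnegative
     factor remains. *)
  have key x y : 0 <= x ->
      \sum_l e p.1 t * (x * (w l t + y * c l t)) * psi i (z l t) <= 0.
    move=> x0; rewrite (eq_bigr (fun l => e p.1 t * x *
        (w l t * psi i (z l t) + y * (c l t * psi i (z l t))))); last first.
      by move=> l _; ring.
    rewrite -mulr_sumr big_split/= -[X in _ + X]mulr_sumr sum_cpsi mulr0 addr0.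
    by rewrite mulr_ge0_le0// mulr_ge0.
  rewrite /W; case: p.2; first exact: key.
  have := key (1 - th p.1 t) (- be p.1 t); rewrite subr_ge0 => /(_ th1).
  by under eq_bigr => l _ do rewrite mulNr.
pose w' p j := W p (lift (r p) j).
pose z' p j := z (lift (r p) j).
have sum_lift p (F : 'I_N.+1 -> R) : F (r p) = 0 -> \sum_j F (lift (r p) j) = \sum_j F j.
  by move=> F0; rewrite [RHS](bigD1_ord (r p))//= F0 add0r.
exists (q * bool)%type, w', z'; split.
- by move=> p; split => [j|j t|j]; [exact: mW|exact: W0|exact: mz].
- move=> p i t; rewrite (sum_lift p (fun l => W p l t * psi i (z l t)))//.
  by rewrite Wr mul0r.
- move=> h h0 t; rewrite /atoms_integral.
  under eq_bigr => p _.
    have -> : (\sum_j (w' p j t)%:E * h (z' p j t) = \sum_l (W p l t)%:E * h (z l t))%E.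
      by rewrite [RHS](bigD1_ord (r p))//= Wr mul0e add0e.
    over.
  rewrite exchange_big/=; apply: eq_bigr => l _.
  rewrite -ge0_sume_distrl; last by move=> p _; rewrite lee_fin.
  by rewrite sumEFin sumW.
Qed.

Lemma caratheodory (n m : nat) (psi : 'I_n -> Z -> R)
    (w : 'I_(m + n.+1) -> T -> R) (z : 'I_(m + n.+1) -> T -> Z) :
  (forall i, measurable_fun setT (psi i)) -> configuration w z ->
  (forall i t, \sum_j w j t * psi i (z j t) <= 0) ->
  exists (I : finType) (w' : I -> 'I_n.+1 -> T -> R) (z' : I -> 'I_n.+1 -> T -> Z),
    [/\ forall p, configuration (w' p) (z' p),
        forall p i t, \sum_j w' p j t * psi i (z' p j t) <= 0 &
        forall h : Z -> \bar R, (forall x, 0 <= h x)%E -> forall t,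
          (\sum_p atoms_integral (w' p) (z' p) h t = atoms_integral w z h t)%E].
Proof.
move=> mpsi; elim: m w z => [|m IH] w z cwz wpsi.
  exists unit, (fun=> w), (fun=> z); split => // h h0 t.
  by rewrite big_const card_unit /= adde0.
have nm : (n < m + n.+1)%N by rewrite addnS ltnS leq_addl.
have [I [w1 [z1 [c1 psi1 h1]]]] := @caratheodory_step n (m + n.+1) psi w z nm mpsi cwz wpsi.
have [J JP] := choice (fun p => IH _ _ (c1 p) (psi1 p)).
(* The types of these families depend on [J p], so they are extracted pointwise from the existential
   after [J] is fixed. *)
pose w2 p := projT1 (cid (JP p)).
pose z2 p := projT1 (cid (projT2 (cid (JP p)))).
have z2P p := projT2 (cid (projT2 (cid (JP p)))).
rewrite -/(w2 _) -/(z2 _) in z2P.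
exists {p : I & J p}, (fun p => w2 (tag p) (tagged p)), (fun p => z2 (tag p) (tagged p)).
split.
- by move=> [p q]; have [+ _ _] := z2P p; apply.
- by move=> [p q] i t; have [_ + _] := z2P p; apply.
- move=> h h0 t; rewrite -h1//.
  rewrite [RHS](eq_bigr (fun p => \sum_(q : J p) atoms_integral (w2 p q) (z2 p q) h t)%E).
    by rewrite [RHS]sig_big_dep/=; apply: eq_bigr => -[].
  by move=> p _; have [_ _ ->] := z2P p.
Qed.

End caratheodory.

(** * Enforcing the moment constraints one at a time *)

Definition represents d (T : measurableType d) d' (Z : measurableType d')
    (R : realType) (P : {measure set Z -> \bar R}) (Q : {measure set T -> \bar R})
    (N : nat) (w : 'I_N -> T -> R) (z : 'I_N -> T -> Z) : Prop :=
  forall h : Z -> \bar R, measurable_fun setT h -> (forall x, 0 <= h x)%E ->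
    (\int[P]_x h x = \int[Q]_t atoms_integral w z h t)%E.

Definition cat_fam (A : Type) (N M : nat) (f : 'I_N -> A) (g : 'I_M -> A)
    (k : 'I_(N + M)) : A :=
  match fintype.split k with inl i => f i | inr j => g j end.

Lemma cat_famP (A : Type) (N M : nat) (f : 'I_N -> A) (g : 'I_M -> A)
    (P : A -> Prop) :
  (forall i, P (f i)) -> (forall j, P (g j)) -> forall k, P (cat_fam f g k).
Proof. by move=> Pf Pg k; rewrite /cat_fam; case: splitP. Qed.

Lemma cat_famL (A : Type) (N M : nat) (f : 'I_N -> A) (g : 'I_M -> A) i :
  cat_fam f g (lshift M i) = f i.
Proof. by rewrite /cat_fam (unsplitK (inl _ i)). Qed.

Lemma cat_famR (A : Type) (N M : nat) (f : 'I_N -> A) (g : 'I_M -> A) j :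
  cat_fam f g (rshift N j) = g j.
Proof. by rewrite /cat_fam (unsplitK (inr _ j)). Qed.

Section pair_step.
Context d' (Z : measurableType d') (R : realType) (P : {measure set Z -> \bar R}).
Variables (d : measure_display) (T : measurableType d)
  (Q : probability T R) (N : nat)
  (w : 'I_N -> T -> R) (z : 'I_N -> T -> Z) (psi : Z -> R).
Hypotheses (cwz : configuration w z) (rep : represents P Q w z)
  (mpsi : measurable_fun setT psi) (ipsi : P.-integrable setT (EFin \o psi))
  (psi_le0 : (\int[P]_x (psi x)%:E <= 0)%E).

Let mw := let: And3 h _ _ := cwz in h.
Let w0 := let: And3 _ h _ := cwz in h.
Let mz := let: And3 _ _ h := cwz in h.

Let g t := \sum_j w j t * psi (z j t).
Let a t : R := Num.max (g t) 0.
Let b t : R := Num.max (- g t) 0.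

Let mg : measurable_fun setT g.
Proof.
apply: measurable_sum => j; apply: measurable_funM => //.
exact: measurableT_comp.
Qed.

Let ma : measurable_fun setT a.
Proof. by apply: measurable_maxr => //; exact: measurable_cst. Qed.

Let mb : measurable_fun setT b.
Proof.
by apply: measurable_maxr; [exact: measurable_funN|exact: measurable_cst].
Qed.

Let a0 t : 0 <= a t. Proof. by rewrite le_max lexx orbT. Qed.
Let b0 t : 0 <= b t. Proof. by rewrite le_max lexx orbT. Qed.

Let A := (\int[Q]_t (a t)%:E)%E.
Let B := (\int[Q]_t (b t)%:E)%E.

(** Formally [A - B] is the integral of [psi]. To avoid subtracting possibly infinite terms, it is
    proved as [A] plus the integral of $\psi^-$ equals [B] plus that of $\psi^+$; finiteness of [B]
    comes from $g^-\le\sum_j w_j\,\psi^-(z_j)$. *)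
Let AltBlt : (A <= B)%E /\ (B < +oo)%E.
Proof.
pose p z : R := Num.max (psi z) 0; pose q z : R := Num.max (- psi z) 0.
have p0 x : 0 <= p x by rewrite le_max lexx orbT.
have q0 x : 0 <= q x by rewrite le_max lexx orbT.
have mp : measurable_fun setT p by apply: measurable_maxr => //; exact: measurable_cst.
have mq : measurable_fun setT q.
  by apply: measurable_maxr; [exact: measurable_funN|exact: measurable_cst].
pose sp t := \sum_j w j t * p (z j t); pose sq t := \sum_j w j t * q (z j t).
have msp : measurable_fun setT sp.
  by apply: measurable_sum => j; apply: measurable_funM => //; exact: measurableT_comp.
have msq : measurable_fun setT sq.
  by apply: measurable_sum => j; apply: measurable_funM => //; exact: measurableT_comp.
have sp0 t : 0 <= sp t by apply: sumr_ge0 => j _; rewrite mulr_ge0.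
have sq0 t : 0 <= sq t by apply: sumr_ge0 => j _; rewrite mulr_ge0.
have gE t : g t = sp t - sq t.
  rewrite /g /sp /sq -sumrB; apply: eq_bigr => j _; rewrite -mulrBr; congr (_ * _).
  by rewrite /p /q; case: (leP (psi (z j t)) 0) => h; case: (leP (- psi (z j t)) 0) => h'; lra.
have spE : (\int[Q]_t (sp t)%:E = \int[P]_x (p x)%:E)%E.
  rewrite rep//; last exact/measurable_EFinP.
  by apply: eq_integral => t _; rewrite /atoms_integral /sp sumEFin.
have sqE : (\int[Q]_t (sq t)%:E = \int[P]_x (q x)%:E)%E.
  rewrite rep//; last exact/measurable_EFinP.
  by apply: eq_integral => t _; rewrite /atoms_integral /sq sumEFin.
have psiE : (\int[P]_x (psi x)%:E = \int[P]_x (p x)%:E - \int[P]_x (q x)%:E)%E.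
  rewrite integralE; congr (_ - _)%E; apply: eq_integral => x _.
    by rewrite funeposE /p EFin_max.
  by rewrite funenegE /q EFin_max EFinN.
have fin (f : Z -> R) : measurable_fun setT f -> (forall x, 0 <= f x <= `|psi x|) ->
    (\int[P]_x (f x)%:E < +oo)%E.
  move=> mf f0; have /integrableP[_] := ipsi; apply: le_lt_trans.
  apply: ge0_le_integral => //=.
  - by move=> x _; rewrite lee_fin; case/andP: (f0 x).
  - exact/measurable_EFinP.
  - by apply/measurable_EFinP; exact: measurableT_comp.
  - by move=> x _; rewrite lee_fin; case/andP: (f0 x).
have pfin : (\int[P]_x (p x)%:E < +oo)%E.
  by apply: fin => // x; rewrite p0 ge_max ler_norm normr_ge0.
have qfin : (\int[P]_x (q x)%:E < +oo)%E.
  by apply: fin => // x; rewrite q0 ge_max -normrN ler_norm normr_ge0.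
have P0 : (0 <= \int[P]_x (p x)%:E)%E by apply: integral_ge0 => x _; rewrite lee_fin.
have Q0 : (0 <= \int[P]_x (q x)%:E)%E by apply: integral_ge0 => x _; rewrite lee_fin.
have A0 : (0 <= A)%E by apply: integral_ge0 => x _; rewrite lee_fin.
have B0 : (0 <= B)%E by apply: integral_ge0 => x _; rewrite lee_fin.
have AB : (A + \int[P]_x (q x)%:E = B + \int[P]_x (p x)%:E)%E.
  rewrite -spE -sqE /A /B -!ge0_integralD//; try by
    [move=> x _; rewrite lee_fin|exact/measurable_EFinP].
  apply: eq_integral => t _; rewrite -!EFinD; congr EFin.
  rewrite /a /b gE; case: (leP (sp t - sq t) 0) => h.
    by case: (leP (- (sp t - sq t)) 0) => h'; lra.
  by case: (leP (- (sp t - sq t)) 0) => h'; lra.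
have Bfin : (B < +oo)%E.
  rewrite /B -[ltLHS]/(\int[Q]_t (b t)%:E)%E; apply: le_lt_trans qfin; rewrite -sqE.
  apply: ge0_le_integral => //=; try by
    [move=> x _; rewrite lee_fin|exact/measurable_EFinP].
  move=> t _; rewrite lee_fin /b gE ge_max sq0 andbT.
  by have := sp0 t; lra.
split => //.
have qnum : (\int[P]_x (q x)%:E)%E \is a fin_num by rewrite ge0_fin_numE.
have pq : (\int[P]_x (p x)%:E <= \int[P]_x (q x)%:E)%E.
  by move: psi_le0; rewrite psiE leeBlDr// add0e.
by rewrite -(leeD2rE _ _ qnum) AB leeD2l.
Qed.

(** The parameter becomes a pair [(x, y)] of independent old parameters. Division by [A] on the left
    and by [B] on the right makes integration over the partner return the part of the old mixture
    with [g <= 0] and the part with [g > 0] respectively. Any constraint that already holds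
    survives, since the new weights are nonnegative multiples of the old ones. *)
Lemma pair_step : exists d1 (T1 : measurableType d1)
    (Q1 : probability T1 R)
    (w1 : 'I_(N + N) -> T1 -> R) (z1 : 'I_(N + N) -> T1 -> Z),
  [/\ configuration w1 z1, represents P Q1 w1 z1,
      forall t, \sum_j w1 j t * psi (z1 j t) <= 0 &
      forall phi : Z -> R, (forall t, \sum_j w j t * phi (z j t) <= 0) ->
        forall t, \sum_j w1 j t * phi (z1 j t) <= 0].
Proof.
have [AB Bfin] := AltBlt.
have A0 : (0 <= A)%E by apply: integral_ge0 => x _; rewrite lee_fin.
(* If [A = 0] there is nothing to divide by, but then [g <= 0] almost everywhere: the mixture is cut
   down to these parameters and padded with [N] atoms of weight zero to reach [N + N]. *)
have [A_eq0|A_neq0] := eqVneq A 0%E.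
  pose ind t : R := if g t <= 0 then 1 else 0.
  have mind : measurable_fun setT ind.
    by apply: measurable_fun_ifT => //; apply: measurable_fun_ler => //; exact: measurable_cst.
  have ind0 t : 0 <= ind t by rewrite /ind; case: ifP.
  pose w1 := cat_fam (fun j t => ind t * w j t) (fun (j : 'I_N) (_ : T) => 0).
  pose z1 := cat_fam z z.
  have sumE F t : \sum_k w1 k t * F (z1 k t) = ind t * \sum_j w j t * F (z j t).
    rewrite big_split_ord/= [X in _ + X]big1 ?addr0.
      by rewrite mulr_sumr; apply: eq_bigr => j _; rewrite /w1 /z1 !cat_famL mulrA.
    by move=> j _; rewrite /w1 cat_famR mul0r.
  exists d, T, Q, w1, z1; split.
  - split; first by apply: cat_famP => j; [exact: measurable_funM|exact: measurable_cst].
      by move=> k t; move: k; apply: (cat_famP (P := fun f => 0 <= f t)) => j //; rewrite mulr_ge0.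
    exact: cat_famP.
  - move=> h mh h0; rewrite rep//.
    have hE t : atoms_integral w1 z1 h t = ((ind t)%:E * atoms_integral w z h t)%E.
      rewrite /atoms_integral big_split_ord/= [X in (_ + X)%E]big1 ?adde0.
        rewrite ge0_sume_distrr; last by move=> j _; rewrite mule_ge0// lee_fin.
        by apply: eq_bigr => j _; rewrite /w1 /z1 !cat_famL EFinM muleA.
      by move=> j _; rewrite /w1 cat_famR mul0e.
    under [RHS]eq_integral => t _ do rewrite hE.
    apply: ge0_ae_eq_integral => //.
    + exact: measurable_atoms_integral.
    + apply: emeasurable_funM; first exact/measurable_EFinP.
      exact: measurable_atoms_integral.
    + by move=> t _; exact: atoms_integral_ge0.
    + by move=> t _; rewrite mule_ge0 ?lee_fin//; exact: atoms_integral_ge0.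
    have : ae_eq Q setT (EFin \o a) (cst 0%E).
      apply/ae_eq_integral_abs => //; first exact/measurable_EFinP.
      rewrite -[RHS]A_eq0; apply: eq_integral => t _ /=.
      by rewrite ger0_norm.
    apply: filterS => t /= at_eq0 _.
    have at0 : a t = 0 by have [] := at_eq0 I.
    rewrite /ind; case: leP => [_|]; first by rewrite mul1e.
    by move: at0; rewrite /a; case: (leP (g t) 0) => // h1 h2; rewrite h2 ltxx in h1.
  - move=> t; rewrite sumE -/(g t) /ind.
    by case: ifP => [h|_]; rewrite ?mul1r ?mul0r.
  - by move=> phi hphi t; rewrite sumE mulr_ge0_le0.
have [rA ArA] : exists rA, A = rA%:E.
  by exists (fine A); rewrite fineK// ge0_fin_numE// (le_lt_trans AB).
have [rB BrB] : exists rB, B = rB%:E.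
  by exists (fine B); rewrite fineK// ge0_fin_numE// (le_trans A0).
have rA0 : 0 < rA by rewrite -lte_fin -ArA lt_neqAle eq_sym A_neq0.
have rAB : rA <= rB by rewrite -lee_fin -ArA -BrB.
have rB0 : 0 < rB by exact: lt_le_trans rAB.
pose il t : R := if g t <= 0 then 1 else 0.
pose ir t : R := if g t <= 0 then 0 else 1.
have mil : measurable_fun setT il.
  by apply: measurable_fun_ifT => //; apply: measurable_fun_ler => //; exact: measurable_cst.
have mir : measurable_fun setT ir.
  by apply: measurable_fun_ifT => //; apply: measurable_fun_ler => //; exact: measurable_cst.
have il0 t : 0 <= il t by rewrite /il; case: ifP.
have ir0 t : 0 <= ir t by rewrite /ir; case: ifP.
pose kl (xy : T * T) := a xy.2 / rA * il xy.1.
pose kr (xy : T * T) := b xy.1 / rB * ir xy.2.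
have mkl : measurable_fun setT kl.
  apply: measurable_funM; last by apply: measurableT_comp => //; exact: measurable_fst.
  by apply: measurable_funM => //; apply: measurableT_comp => //; exact: measurable_snd.
have mkr : measurable_fun setT kr.
  apply: measurable_funM; last by apply: measurableT_comp => //; exact: measurable_snd.
  by apply: measurable_funM => //; apply: measurableT_comp => //; exact: measurable_fst.
have kl0 xy : 0 <= kl xy by rewrite mulr_ge0// divr_ge0// ltW.
have kr0 xy : 0 <= kr xy by rewrite mulr_ge0// divr_ge0// ltW.
pose w1 := cat_fam (fun j (xy : T * T) => kl xy * w j xy.1) (fun j xy => kr xy * w j xy.2).
pose z1 := cat_fam (fun j (xy : T * T) => z j xy.1) (fun j xy => z j xy.2).
have sumE F xy : \sum_k w1 k xy * F (z1 k xy) =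
    kl xy * (\sum_j w j xy.1 * F (z j xy.1)) + kr xy * (\sum_j w j xy.2 * F (z j xy.2)).
  rewrite big_split_ord/= !mulr_sumr; congr (_ + _); apply: eq_bigr => j _.
    by rewrite /w1 /z1 !cat_famL mulrA.
  by rewrite /w1 /z1 !cat_famR mulrA.
have cwz1 : configuration w1 z1.
  split.
  - apply: cat_famP => j; apply: measurable_funM => //; apply: measurableT_comp => //;
      by [exact: measurable_fst|exact: measurable_snd].
  - by move=> k t; move: k; apply: (cat_famP (P := fun f => 0 <= f t)) => j //; rewrite mulr_ge0.
  - apply: cat_famP => j; apply: measurableT_comp => //;
      by [exact: measurable_fst|exact: measurable_snd].
exists _, (T * T)%type, (Q \x Q)%E, w1, z1; split => //.
- move=> h mh h0; rewrite rep//.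
  pose S := atoms_integral w z h.
  have mS : measurable_fun setT S by exact: measurable_atoms_integral.
  have S0 t : (0 <= S t)%E by exact: atoms_integral_ge0.
  have hE xy : atoms_integral w1 z1 h xy =
      ((kl xy)%:E * S xy.1 + (kr xy)%:E * S xy.2)%E.
    rewrite /atoms_integral big_split_ord/=; congr (_ + _)%E.
      rewrite ge0_sume_distrr; last by move=> j _; rewrite mule_ge0// lee_fin.
      by apply: eq_bigr => j _; rewrite /w1 /z1 !cat_famL EFinM muleA.
    rewrite ge0_sume_distrr; last by move=> j _; rewrite mule_ge0// lee_fin.
    by apply: eq_bigr => j _; rewrite /w1 /z1 !cat_famR EFinM muleA.
  under [RHS]eq_integral => t _ do rewrite hE.
  have mS1 : measurable_fun setT (fun xy : T * T => (kl xy)%:E * S xy.1)%E.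
    apply: emeasurable_funM; first exact/measurable_EFinP.
    by apply: measurableT_comp => //; exact: measurable_fst.
  have mS2 : measurable_fun setT (fun xy : T * T => (kr xy)%:E * S xy.2)%E.
    apply: emeasurable_funM; first exact/measurable_EFinP.
    by apply: measurableT_comp => //; exact: measurable_snd.
  have S10 (xy : T * T) : (0 <= (kl xy)%:E * S xy.1)%E by rewrite mule_ge0// lee_fin.
  have S20 (xy : T * T) : (0 <= (kr xy)%:E * S xy.2)%E by rewrite mule_ge0// lee_fin.
  rewrite [RHS]ge0_integralD//.
  rewrite [X in (_ = X + _)%E]fubini_tonelli1// [X in (_ = _ + X)%E]fubini_tonelli2//.
  (* The integral of [a] over the partner is [rA], which cancels the denominator. *)
  have E1 x : fubini_F Q (fun xy : T * T => (kl xy)%:E * S xy.1)%E x = ((il x)%:E * S x)%E.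
    rewrite /fubini_F /kl/=.
    under eq_integral => y _.
      rewrite (_ : _ * _ = (a y)%:E * ((rA^-1 * il x)%:E * S x))%E; last first.
        by rewrite -mulrA EFinM muleA.
      over.
    rewrite ge0_integralZr//; last first.
    + by rewrite mule_ge0// lee_fin mulr_ge0// invr_ge0 ltW.
    + by move=> y _; rewrite lee_fin.
    + exact/measurable_EFinP.
    by rewrite -/A ArA muleA -EFinM mulrA divff ?gt_eqF// mul1r.
  have E2 y : fubini_G Q (fun xy : T * T => (kr xy)%:E * S xy.2)%E y = ((ir y)%:E * S y)%E.
    rewrite /fubini_G /kr/=.
    under eq_integral => x _.
      rewrite (_ : _ * _ = (b x)%:E * ((rB^-1 * ir y)%:E * S y))%E; last first.
        by rewrite -mulrA EFinM muleA.
      over.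
    rewrite ge0_integralZr//; last first.
    + by rewrite mule_ge0// lee_fin mulr_ge0// invr_ge0 ltW.
    + by move=> x _; rewrite lee_fin.
    + exact/measurable_EFinP.
    by rewrite -/B BrB muleA -EFinM mulrA divff ?gt_eqF// mul1r.
  under [X in (_ = X + _)%E]eq_integral => x _ do rewrite E1.
  under [X in (_ = _ + X)%E]eq_integral => x _ do rewrite E2.
  rewrite -ge0_integralD//; last first.
  + by apply: emeasurable_funM => //; exact/measurable_EFinP.
  + by move=> x _; rewrite mule_ge0// lee_fin.
  + by apply: emeasurable_funM => //; exact/measurable_EFinP.
  + by move=> x _; rewrite mule_ge0// lee_fin.
  apply: eq_integral => t _; rewrite /il /ir; case: ifP => _.
    by rewrite mul1e mul0e adde0.
  by rewrite mul1e mul0e add0e.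
- move=> xy; rewrite sumE -/(g xy.1) -/(g xy.2) /kl /kr /il /ir.
  have rV : rB^-1 <= rA^-1 by rewrite lef_pV2.
  have [g1|g1] := leP (g xy.1) 0; last first.
    rewrite (_ : b xy.1 = 0) ?(mulr0, mul0r, addr0)//.
    by apply/max_idPr; rewrite oppr_le0 ltW.
  rewrite !mulr1; have [g2|g2] := leP (g xy.2) 0.
    by rewrite (_ : a xy.2 = 0) ?(mulr0, mul0r, addr0)//; exact/max_idPr.
  rewrite mulr1 (_ : a xy.2 = g xy.2); last by apply/max_idPl; exact: ltW.
  rewrite (_ : b xy.1 = - g xy.1); last by apply/max_idPl; rewrite oppr_ge0.
  (* Here the first value of [g] is nonpositive and the second positive; the mean inequality, in the
     form [rA <= rB], decides the sign. *)
  rewrite (_ : _ + _ = (g xy.1 * g xy.2) * (rA^-1 - rB^-1)); last by ring.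
  by rewrite mulr_le0_ge0 ?subr_ge0// mulr_le0_ge0// ltW.
- by move=> phi hphi xy; rewrite sumE -[leRHS]addr0 lerD// mulr_ge0_le0.
Qed.

End pair_step.

Lemma moment_decomposition d' (Z : measurableType d') (R : realType)
    (P : probability Z R) (n : nat) (psi : 'I_n -> Z -> R) :
  (forall i, measurable_fun setT (psi i)) ->
  (forall i, P.-integrable setT (EFin \o psi i)) ->
  (forall i, \int[P]_x (psi i x)%:E <= 0)%E ->
  exists d (T : measurableType d) (Q : probability T R) (I : finType)
      (w : I -> 'I_n.+1 -> T -> R) (z : I -> 'I_n.+1 -> T -> Z),
    [/\ forall p, configuration (w p) (z p),
        forall p i t, \sum_j w p j t * psi i (z p j t) <= 0 &
        forall h : Z -> \bar R, measurable_fun setT h -> (forall x, 0 <= h x)%E ->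
          (\int[P]_x h x = \sum_p \int[Q]_t atoms_integral (w p) (z p) h t)%E].
Proof.
move=> mpsi ipsi psi_le0.
(* The first [k] constraints hold pointwise. The clause [k < N] yields at least [n + 1] atoms at the
   end, the format from which the reduction starts. *)
have H k : (k <= n)%N -> exists d (T : measurableType d) (Q : probability T R) N
    (w : 'I_N -> T -> R) (z : 'I_N -> T -> Z),
    [/\ (k < N)%N, configuration w z, represents P Q w z &
        forall i : 'I_n, (i < k)%N -> forall t, \sum_j w j t * psi i (z j t) <= 0].
  elim: k => [_|k IH kn].
    (* The trivial mixture: the point itself is the parameter and carries a single atom of mass
       1. *)
    exists d', Z, P, 1%N, (fun _ _ => 1), (fun _ => id); split => //.
    move=> h mh h0; apply: eq_integral => x _.
    by rewrite /atoms_integral big_ord1 mul1e.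
  have [d [T [Q [N [w [z [kN cwz rep wpsi]]]]]]] := IH (ltnW kn).
  have [d1 [T1 [Q1 [w1 [z1 [c1 rep1 psi1 keep1]]]]]] :=
    pair_step cwz rep (mpsi (Ordinal kn)) (ipsi _) (psi_le0 _).
  exists d1, T1, Q1, (N + N)%N, w1, z1; split => //.
    by rewrite -addn1 leq_add// (leq_ltn_trans _ kN).
  move=> i; rewrite ltnS leq_eqVlt => /predU1P[ik|ik] t.
    by rewrite (_ : i = Ordinal kn)//; exact: val_inj.
  by apply: keep1 => s; exact: wpsi.
have [d [T [Q [N [w [z [nN cwz rep wpsi]]]]]]] := H n (leqnn n).
have [m Nm] : exists m, N = (m + n.+1)%N by exists (N - n.+1)%N; rewrite subnK.
subst N.
have [I [w1 [z1 [c1 psi1 h1]]]] := caratheodory mpsi cwz (fun i => wpsi i (ltn_ord i)).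
exists d, T, Q, I, w1, z1; split => // h mh h0.
rewrite rep// -ge0_integral_sum//.
- by apply: eq_integral => t _; rewrite h1.
- by move=> p; exact: measurable_atoms_integral.
- by move=> p t _; exact: atoms_integral_ge0.
Qed.

(** * Unimodal measures as mixtures of Lebesgue measure on segments *)

Lemma convex_functionP (R : realType) (D : set R) (f : R -> R) :
  @convex_function R R^o D f <->
  forall x y t, D x -> D y -> 0 <= t <= 1 ->
    f (t * x + (1 - t) * y) <= t * f x + (1 - t) * f y.
Proof.
split=> [cf x y t Dx Dy /andP[t0 t1]|cf t x y /set_mem Dx /set_mem Dy].
  by have := cf (Itv01 t0 t1) x y (mem_set Dx) (mem_set Dy).
apply: cf => //; apply/andP; split; [exact: ge0|exact: le1].
Qed.

(** Cut [[x, y]] into $N+1$ equal steps: the bounds telescope to [(H x - H y) * (y - x)] divided by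
    $N+1$, which tends to 0. Below, [G] is the difference of two distribution functions squeezed
    between the same rectangles, with heights given by [H]. *)
Lemma eq_of_small_increments (R : realType) (J : R -> Prop) (G H : R -> R) :
  (forall x y z, J x -> J z -> x <= y <= z -> J y) ->
  (forall x y, J x -> J y -> x < y -> `|G y - G x| <= (H x - H y) * (y - x)) ->
  forall x y, J x -> J y -> x <= y -> G x = G y.
Proof.
move=> Jitv GH x y Jx Jy; rewrite le_eqVlt => /predU1P[->//|xy].
pose h N := (y - x) / N.+1%:R; pose p N (k : nat) := x + h N * k%:R.
have h0 N : 0 < h N by rewrite divr_gt0// subr_gt0.
have pE N : p N N.+1 = y by rewrite /p /h divfK ?pnatr_eq0//; lra.
have Jp N k : (k <= N.+1)%N -> J (p N k).
  move=> kN; apply: (Jitv x _ y) => //; rewrite lerDl mulr_ge0 ?(ltW (h0 N))//=.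
  by rewrite -(pE N) lerD2l ler_pM2l// ler_nat.
have step N k : (k < N.+1)%N -> `|G (p N k.+1) - G (p N k)| <=
    (H (p N k) - H (p N k.+1)) * h N.
  move=> kN; have hE : p N k.+1 - p N k = h N by rewrite /p -natr1; ring.
  by rewrite -[in leRHS]hE; apply: GH; [exact/Jp/ltnW|exact: Jp|rewrite -subr_gt0 hE].
have tele N k : (k <= N.+1)%N -> `|G (p N k) - G x| <= (H x - H (p N k)) * h N.
  elim: k => [_|k IH kN]; first by rewrite /p mulr0 addr0 !subrr normr0 mul0r.
  have := IH (ltnW kN); have := step N k kN => h1 h2.
  have -> : G (p N k.+1) - G x = (G (p N k.+1) - G (p N k)) + (G (p N k) - G x) by ring.
  apply: le_trans (ler_normD _ _) _.
  have -> : (H x - H (p N k.+1)) * h N =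
    (H (p N k) - H (p N k.+1)) * h N + (H x - H (p N k)) * h N by ring.
  exact: lerD.
have bnd N : `|G y - G x| <= (H x - H y) * ((y - x) / N.+1%:R).
  by have := tele N _ (leqnn _); rewrite pE.
apply/eqP; rewrite eq_sym -subr_eq0 -normr_eq0; apply/eqP/le_anti.
rewrite normr_ge0 andbT; apply/ler_addgt0Pr => e e0; rewrite add0r.
pose K := `|(H x - H y) * (y - x)|.
rewrite (le_trans (bnd (Num.truncn (K / e))))//.
rewrite mulrA ler_pdivrMr//; apply: (le_trans (ler_norm _)).
by have := ltW (truncnS_gt (K / e)); rewrite ler_pdivrMr// mulrC.
Qed.

(* [D] is the right derivative of the concave function [F]. *)
Lemma concave_slopes (R : realType) (a : R) (F : R -> R) :
  @convex_function R R^o [set` `]a, +oo[] (\- F) ->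
  exists D : R -> R, forall c d, a < c -> c < d ->
    D d * (d - c) <= F d - F c <= D c * (d - c).
Proof.
move=> /convex_functionP cF.
have slope c d y : a < c -> c < d -> d < y ->
    (F y - F d) / (y - d) <= (F d - F c) / (d - c).
  move=> ac cd dy.
  have dc : 0 < d - c by rewrite subr_gt0.
  have yd : 0 < y - d by rewrite subr_gt0.
  have yc : 0 < y - c by lra.
  have := cF c y ((y - d) / (y - c)); rewrite /= !in_itv/= !andbT.
  move=> /(_ ac (lt_trans (lt_trans ac cd) dy)).
  have t1 : (y - d) / (y - c) <= 1 by rewrite ler_pdivrMr// mul1r; lra.
  rewrite divr_ge0 ?(ltW yd) ?(ltW yc)// t1 => /(_ isT).
  have -> : (y - d) / (y - c) * c + (1 - (y - d) / (y - c)) * y = d.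
    by field; rewrite gt_eqF.
  have -> : (y - d) / (y - c) * - F c + (1 - (y - d) / (y - c)) * - F y =
      - ((y - d) * F c + (d - c) * F y) / (y - c).
    by field; rewrite gt_eqF.
  rewrite ler_pdivlMr// => h.
  by rewrite ler_pdivrMr// mulrAC ler_pdivlMr//; lra.
pose S d := [set (F y - F d) / (y - d) | y in [set y | d < y]].
have ubS d c : a < c -> c < d -> ubound (S d) ((F d - F c) / (d - c)).
  by move=> ac cd _ [y dy <-]; exact: slope.
have S0 d : S d !=set0 by exists ((F (d + 1) - F d) / (d + 1 - d)), (d + 1) => //=; lra.
exists (fun d => sup (S d)) => c d ac cd.
have dc : 0 < d - c by rewrite subr_gt0.
apply/andP; split.
  by rewrite -ler_pdivlMr//; apply: ge_sup => //; exact: ubS.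
rewrite -ler_pdivrMr//; apply: ub_le_sup; last by exists d.
(* A point between [a] and [c] is needed: the slope from it to [c] bounds all slopes to the right of
   [c], so the supremum is genuine. *)
have m1 : a < (a + c) / 2 by lra.
have m2 : (a + c) / 2 < c by lra.
by exists ((F c - F ((a + c) / 2)) / (c - (a + c) / 2)); exact: ubS.
Qed.

Lemma eq_measure_ocitv (R : realType) (m1 m2 : {measure set (measurableTypeR R) -> \bar R}) :
  (m1 setT < +oo)%E ->
  (forall c d, c < d -> m1 `]c, d]%classic = m2 `]c, d]%classic) ->
  forall A, measurable A -> m1 A = m2 A.
Proof.
move=> m1oo m12 A mA.
apply: (@measure_unique _ R (measurableTypeR R) (@ocitv R)
  (fun n => `](- n%:R), n%:R]%classic) _ _ _ _ m1 m2) => //.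
- exact: ocitvI.
- move=> n; exact: is_ocitv.
- apply/seteqP; split => // x _; exists (Num.truncn `|x|).+1 => //=.
  have := truncnS_gt `|x|; rewrite in_itv/= ltr_norml => /andP[-> /ltW].
  by move->.
- move=> _ [[c d] _ <-]/=; have [cd|dc] := ltP c d; first exact: m12.
  by rewrite set_itv_ge ?measure0// bnd_simp -leNgt.
- by move=> k; apply: le_lt_trans m1oo; apply: le_measure; rewrite ?inE.
Qed.

(** The comparison of densities works only strictly to the right of [a], because the density may
    blow up there; continuity from below reaches the interval that starts at [a]. *)
Lemma eq_measure_left_limit (R : realType)
    (m1 m2 : {measure set (measurableTypeR R) -> \bar R}) (a d : R) :
  (forall c, a < c -> c < d -> m1 `]c, d]%classic = m2 `]c, d]%classic) ->
  m1 `]a, d]%classic = m2 `]a, d]%classic.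
Proof.
move=> m12; have [ad|da] := ltP a d; last first.
  by rewrite set_itv_ge ?measure0// bnd_simp -leNgt.
(* The denominator starts at 2, so every left end lies strictly below [d]. *)
pose F (k : nat) := `](a + (d - a) / k.+2%:R), d]%classic.
have -> : `]a, d]%classic = \bigcup_k F k.
  apply/seteqP; split => x /=; rewrite in_itv/=.
    move=> /andP[ax xd]; exists (Num.truncn ((d - a) / (x - a))) => //=.
    rewrite /F /= in_itv/= xd andbT -ltrBrDl ltr_pdivrMr//.
    have := truncnS_gt ((d - a) / (x - a)); rewrite ltr_pdivrMr ?subr_gt0// mulrC.
    by move=> /lt_trans; apply; rewrite ltr_pM2l ?subr_gt0// ltr_nat.
  move=> [k _]; rewrite /F /= in_itv/= => /andP[h ->]; rewrite andbT.
  by apply: lt_trans h; rewrite ltrDl divr_gt0// subr_gt0.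
have mono : {homo F : n p / (n <= p)%N >-> (n <= p)%O}.
  move=> n p np; apply/subsetPset => x; rewrite /F /= !in_itv/= => /andP[h ->].
  rewrite andbT; apply: le_lt_trans h; rewrite lerD2l ler_pM2l ?subr_gt0//.
  by rewrite lef_pV2 ?posrE// ler_nat.
have mF k : measurable (F k) by exact: measurable_itv.
have mU : measurable (\bigcup_k F k) by exact: bigcupT_measurable.
have c1 := nondecreasing_cvg_mu (mu := m1) mF mU mono.
have c2 := nondecreasing_cvg_mu (mu := m2) mF mU mono.
have m12F : m1 \o F = m2 \o F.
  apply/funext => k /=; apply: m12.
    by rewrite ltrDl divr_gt0// subr_gt0.
  by rewrite -ltrBrDl ltr_pdivrMr// ltr_pMr ?subr_gt0// ltr1n.
by move: c1; rewrite m12F => /cvg_unique; apply.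
Qed.

(* A measure with a nonincreasing density [D] on the half-line is the integral,
   over the levels [y], of Lebesgue measure on the superlevel sets [D > y]. *)
Lemma half_line_layers (R : realType) (m : {measure set (measurableTypeR R) -> \bar R})
    (a : R) (D : R -> R) :
  (m setT < +oo)%E ->
  (forall c d, a < c -> c < d -> ((D d * (d - c))%:E <= m `]c, d]%classic)%E /\
                                 (m `]c, d]%classic <= (D c * (d - c))%:E)%E) ->
  exists z : R -> R, [/\ measurable_fun setT z, forall y, a <= z y,
    forall y c d, a < c -> c < d -> d < z y -> (0 < m `]c, d]%classic)%E &
    forall h : R -> \bar R, measurable_fun (setT : set R) h -> (forall x, 0 <= h x)%E ->
      (\int[m]_(x in `]a, +oo[%classic) h x =
       \int[lebesgue_measure]_y \int[lebesgue_measure]_(x in `]a, z y[%classic) h x)%E].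
Proof.
move=> moo Dm.
have mfin A : measurable A -> m A \is a fin_num.
  move=> mA; rewrite ge0_fin_numE//; apply: le_lt_trans moo.
  by apply: le_measure; rewrite ?inE.
have D_ge0 c : a < c -> 0 <= D c.
  move=> ac; have cc : c < c + 1 by rewrite ltrDl.
  have [_] := Dm c (c + 1) ac cc; rewrite [c + 1]addrC addrK mulr1 => /(le_trans _).
  by move=> /(_ 0%E (measure_ge0 _ _)); rewrite lee_fin.
have D_anti c d : a < c -> c < d -> D d <= D c.
  move=> ac cd; have [h1 h2] := Dm c d ac cd.
  by have := le_trans h1 h2; rewrite lee_fin ler_pM2r// subr_gt0.
(* Adding [a] keeps the set nonempty, so its supremum is at least [a]. For [y <= 0] the superlevel
   set can be unbounded, and [z] is set to [a], which makes the layer empty. *)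
pose S y := [set x | x = a \/ (a < x /\ y < D x)].
have Sa y : S y a by left.
have ubS y : 0 < y -> has_ubound (S y).
  move=> y0; exists (a + 2 * fine (m setT) / y) => x [->|[ax yD]].
    by rewrite lerDl divr_ge0 ?mulr_ge0 ?fine_ge0// ltW.
  (* The right half of [[a, x]] has mass at least half of [D x * (x - a)]; finiteness of [m] thus
     bounds [x] when [D x > y > 0]. *)
  have [h _] := Dm ((a + x) / 2) x ltac:(lra) ltac:(lra).
  have : (D x * (x - (a + x) / 2) <= fine (m setT)).
    rewrite -lee_fin fineK ?mfin//; apply: le_trans h _.
    by apply: le_measure; rewrite ?inE.
  move=> {}h; rewrite -lerBlDl ler_pdivlMr//.
  have : y * (x - a) <= D x * (x - a) by rewrite ler_pM2r ?subr_gt0// ltW.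
  by lra.
pose z y := if 0 < y then sup (S y) else a.
have z_ge y : a <= z y.
  by rewrite /z; case: ifP => // y0; apply: ub_le_sup => //; exact: ubS.
have z_gt y c : a < c -> c < z y -> 0 < y /\ y < D c.
  move=> ac; rewrite /z; case: ifP => [y0 cz|_ ca]; last first.
    by have := lt_trans ac ca; rewrite ltxx.
  split => //; have [x [->|[ax yx]] cx] := sup_gt (ex_intro _ a (Sa y)) cz.
    by have := lt_trans ac cx; rewrite ltxx.
  by apply: lt_le_trans yx _; exact: D_anti.
have z_le y c : a < c -> 0 < y -> y < D c -> c <= z y.
  by move=> ac y0 yD; rewrite /z y0; apply: ub_le_sup; [exact: ubS|right].
have mz : measurable_fun setT z.
  apply: (measurability (@RGenOInfty.G R)) => [|/= _ [_] [r] -> <-].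
    exact: RGenOInfty.measurableE.
  rewrite setTI; have [ra|ar] := ltP r a.
    rewrite (_ : _ @^-1` _ = setT)//; apply/seteqP; split => // y _.
    by rewrite /= in_itv/= andbT (lt_le_trans ra).
  (* [z] is nonincreasing on positive levels and equals [a] elsewhere, so for [r >= a] its
     superlevel set is an interval. *)
  apply: is_interval_measurable => s t /=; rewrite !in_itv/= !andbT => rs rt u /andP[su ut].
  have [s0|s0] := ltP 0 s; last first.
    by move: rs; rewrite /z (le_gtF s0) ltNge ar.
  have u0 : 0 < u by exact: lt_le_trans su.
  have t0 : 0 < t by exact: lt_le_trans ut.
  rewrite in_itv/= andbT; apply: lt_le_trans rt _.
  rewrite /z t0 u0; apply: ge_sup; first by exists a.
  move=> x [->|[ax tx]]; first by apply: ub_le_sup => //; exact: ubS.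
  by apply: ub_le_sup; [exact: ubS|right; split => //; exact: le_lt_trans tx].
pose E := [set yx : measurableTypeR R * measurableTypeR R | a < yx.2 < z yx.1].
have mE : measurable E.
  apply: (@measurable_fun_bool_set _ _ (fun yx => (a < yx.2) && (yx.2 < z yx.1))).
  apply: measurable_and; apply: measurable_fun_ltr => //; try exact: measurable_snd.
  by apply: measurableT_comp => //; exact: measurable_fst.
have secE y : xsection E y = `]a, z y[%classic.
  by apply/seteqP; split => x; rewrite /xsection/= in_itv/= in_setE.
have [m' m'E] := section_measure lebesgue_measure lebesgue_measure mE.
have m'A A : measurable A ->
    (m' A = \int[lebesgue_measure]_y lebesgue_measure (A `&` `]a, z y[%classic))%E.
  move=> mA; have m1A : measurable_fun setT (fun x : measurableTypeR R => (\1_A x)%:E : \bar R).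
    exact/measurable_EFinP/measurable_indic.
  have A0 (x : R) : (0 <= (\1_A x)%:E :> \bar R)%E by rewrite lee_fin.
  have := m'E _ m1A A0; rewrite integral_indic// setIT => ->.
  by apply: eq_integral => y _; rewrite secE integral_indic.
have mL A : measurable A -> measurable_fun (setT : set (measurableTypeR R))
    (fun y => lebesgue_measure (A `&` `]a, z y[%classic)).
  move=> mA; have mB : measurable (E `&` (setT `*` A)).
    by apply: measurableI => //; exact: measurableX.
  have := measurable_fun_xsection lebesgue_measure mB.
  congr (measurable_fun _ _); apply/funext => y /=; congr (lebesgue_measure _).
  apply/seteqP; split => x; rewrite /xsection /= in_setE /= in_itv/=.
    by move=> [axz [tt Ax]]; split.
  by move=> [Ax axz]; split.
(* Only levels in []0, D c[] have a layer reaching beyond [c], and conversely the layers of levels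
   in []0, D d[] contain []c, d[]. So [m'] obeys the same rectangle bounds as [m]. *)
have m'_le c d : a < c -> c < d -> (m' `]c, d]%classic <= (D c * (d - c))%:E)%E.
  move=> ac cd; rewrite m'A//.
  apply: (@le_trans _ _ (\int[lebesgue_measure]_y ((d - c)%:E * (\1_`]0%R, D c]%classic y)%:E))%E).
    apply: ge0_le_integral => //.
    - exact: mL.
    - by apply: measurable_funeM; exact/measurable_EFinP/measurable_indic.
    move=> y _; have [zc|cz] := leP (z y) c.
      rewrite (_ : _ `&` _ = set0) ?measure0.
        by rewrite mule_ge0// lee_fin subr_ge0 ltW.
      apply/seteqP; split => // x /=; rewrite !in_itv/= => -[/andP[cx _] /andP[_ xz]].
      by have := lt_le_trans (lt_trans cx xz) zc; rewrite ltxx.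
    have [y0 yD] := z_gt _ _ ac cz.
    rewrite indicE mem_set ?mule1/= ?in_itv/= ?y0 ?(ltW yD)//.
    apply: (@le_trans _ _ (lebesgue_measure `]c, d]%classic)).
      by apply: le_measure; rewrite ?inE//; do ?[exact: measurableI]; exact: subIsetl.
    by rewrite lebesgue_measure_itv/= lte_fin cd.
  rewrite ge0_integralZl_EFin//; last 2 first.
  - exact/measurable_EFinP/measurable_indic.
  - by rewrite subr_ge0 ltW.
  rewrite integral_indic//= setIT lebesgue_measure_itv/= lte_fin.
  rewrite mulrC EFinM; case: ifP => _; first by rewrite oppr0 adde0.
  by rewrite mule0 mule_ge0// lee_fin ?subr_ge0 ?(ltW cd)// D_ge0.
have m'_ge c d : a < c -> c < d -> ((D d * (d - c))%:E <= m' `]c, d]%classic)%E.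
  move=> ac cd; rewrite m'A//.
  apply: (@le_trans _ _ (\int[lebesgue_measure]_y ((d - c)%:E * (\1_`]0%R, D d[%classic y)%:E))%E).
    rewrite ge0_integralZl_EFin//; last 2 first.
    - exact/measurable_EFinP/measurable_indic.
    - by rewrite subr_ge0 ltW.
    rewrite integral_indic//= setIT lebesgue_measure_itv/= lte_fin.
    rewrite mulrC EFinM; case: ltP => [_|D0]; first by rewrite oppr0 adde0.
    rewrite mule0 mule_ge0_le0// lee_fin ?subr_ge0//; exact: ltW.
  apply: ge0_le_integral => //.
  - by move=> y _; rewrite mule_ge0// lee_fin subr_ge0 ltW.
  - by apply: measurable_funeM; exact/measurable_EFinP/measurable_indic.
  - exact: mL.
  move=> y _; rewrite indicE; have [/set_mem|] := boolP (_ \in _); last by rewrite mule0.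
  rewrite /= in_itv/= => /andP[y0 yD]; have dz := z_le _ _ (lt_trans ac cd) y0 yD.
  rewrite mule1; apply: (@le_trans _ _ (lebesgue_measure `]c, d[%classic)).
    by rewrite lebesgue_measure_itv/= lte_fin cd.
  apply: le_measure; rewrite ?inE//; do ?[exact: measurableI].
  move=> x /=; rewrite !in_itv/= => /andP[cx xd]; rewrite cx (ltW xd) (lt_trans ac cx).
  by rewrite (lt_le_trans xd dz).
have mm' c d : a < c -> c < d -> m `]c, d]%classic = m' `]c, d]%classic.
  move=> ac cd.
  have m'fin x y : c <= x -> x <= y -> m' `]x, y]%classic \is a fin_num.
    move=> cx; rewrite le_eqVlt => /predU1P[->|xy].
      by rewrite set_itv_ge ?measure0// bnd_simp ltxx.
    rewrite ge0_fin_numE//; apply: le_lt_trans (m'_le _ _ (lt_le_trans ac cx) xy) _.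
    exact: ltry.
  pose G x := fine (m `]c, x]%classic) - fine (m' `]c, x]%classic).
  have split_itv x y : c <= x -> x <= y ->
      `]c, y]%classic = `]c, x]%classic `|` `]x, y]%classic.
    by move=> cx xy; rewrite -itv_bndbnd_setU// bnd_simp.
  have disj x y : `]c, x]%classic `&` `]x, y]%classic = set0 :> set R.
    apply/seteqP; split => // t /=; rewrite !in_itv/= => -[/andP[_ tx] /andP[xt _]].
    by have := lt_le_trans xt tx; rewrite ltxx.
  have addm (n : {measure set (measurableTypeR R) -> \bar R}) x y : c <= x -> x <= y ->
      n `]c, y]%classic = (n `]c, x]%classic + n `]x, y]%classic)%E.
    by move=> cx xy; rewrite (split_itv x y)// measureU//; exact: disj.
  have GE x y : c <= x -> x < y ->
      G y - G x = fine (m `]x, y]%classic) - fine (m' `]x, y]%classic).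
    move=> cx xy; have xy' := ltW xy.
    rewrite /G (addm m x y)// (addm m' x y)// !fineD ?mfin ?m'fin//; lra.
  have GH x y : c <= x -> c <= y -> x < y -> `|G y - G x| <= (D x - D y) * (y - x).
    move=> cx cy xy; rewrite GE//.
    have ax := lt_le_trans ac cx.
    have [] := Dm _ _ ax xy; have := m'_le _ _ ax xy; have := m'_ge _ _ ax xy.
    rewrite -{1 2}[m' _]fineK ?m'fin// ?(ltW xy)// -{1 2}[m _]fineK ?mfin//.
    rewrite !lee_fin ler_norml => h1 h2 h3 h4; apply/andP; split; lra.
  have := @eq_of_small_increments R (fun x => c <= x) G D _ GH c d (lexx _) (ltW cd) (ltW cd).
  have Gc : G c = 0 by rewrite /G set_itv_ge ?measure0 ?subrr// bnd_simp ltxx.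
  rewrite Gc => /(_ (fun x y w cx _ xyw => le_trans cx (andP xyw).1)) /esym/eqP.
  rewrite subr_eq0 => /eqP h.
  by rewrite -[LHS]fineK ?mfin// h fineK// m'fin// ltW.
exists z; split; [exact: mz|exact: z_ge| |].
  move=> y c d ac cd dz; have [y0 yD] := z_gt _ _ (lt_trans ac cd) dz.
  have [+ _] := Dm _ _ ac cd; apply: lt_le_trans.
  by rewrite lte_fin mulr_gt0 ?subr_gt0// (lt_trans y0).
move=> h mh h0; have mI : measurable (`]a, +oo[%classic : set (measurableTypeR R)) by [].
rewrite -(ge0_integral_mrestr _ mI)//.
rewrite (eq_measure_integral m'); first last.
  move=> A mA _; apply: eq_measure_ocitv => //.
    by apply: le_lt_trans moo; apply: le_measure; rewrite ?inE//; do ?[exact: measurableI].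
  move=> c d cd; rewrite /= /mrestr.
  have [da|ad] := leP d a.
    rewrite (_ : _ `&` _ = set0) ?measure0; last first.
      apply/seteqP; split => // t /=; rewrite !in_itv/= andbT => -[/andP[_ td] at_].
      by have := lt_le_trans at_ (le_trans td da); rewrite ltxx.
    rewrite m'A// integral0_eq// => y _.
    rewrite (_ : _ `&` _ = set0) ?measure0//.
    apply/seteqP; split => // t /=; rewrite !in_itv/= => -[/andP[_ td] /andP[at_ _]].
    by have := lt_le_trans at_ (le_trans td da); rewrite ltxx.
  have [ca|ac] := leP c a; last first.
    rewrite setIidl ?mm'// => t /=; rewrite !in_itv/= => /andP[ct _].
    by rewrite (lt_trans ac ct).
  transitivity (m `]a, d]%classic).
    congr (m _); apply/seteqP; split => t /=; rewrite !in_itv/=.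
      by rewrite andbT => -[/andP[_ ->] ->].
    by move=> /andP[at_ ->]; rewrite at_ (le_lt_trans ca at_).
  rewrite (eq_measure_left_limit (fun c ac cd => mm' c d ac cd)).
  rewrite (m'A _ (measurable_itv `]a, d])) (m'A _ (measurable_itv `]c, d])).
  apply: eq_integral => y _; congr (lebesgue_measure _).
  apply/seteqP; split => t /=; rewrite !in_itv/=.
    by move=> [/andP[at_ ->] ->]; rewrite (le_lt_trans ca at_).
  by move=> [/andP[_ ->] /andP[-> ->]].
by rewrite (m'E h mh h0); apply: eq_integral => y _; rewrite (secE y).
Qed.

Lemma ge0_integral_oppr (R : realType) (h : R -> \bar R) (a b : R) :
  measurable_fun (setT : set R) h -> (forall x, 0 <= h x)%E ->
  (\int[lebesgue_measure]_(x in `](- b)%R, (- a)%R[%classic) h (- x)%R =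
   \int[lebesgue_measure]_(x in `]a, b[%classic) h x)%E.
Proof.
move=> mh h0.
have [m' m'A m'I] :=
  @pushforward_measureP _ _ (measurableTypeR R) (measurableTypeR R) R
    (@lebesgue_measure R) -%R (@oppr_measurable R setT).
have mI : measurable (`]a, b[%classic : set (measurableTypeR R)) by [].
rewrite [RHS]integral_mkcond; transitivity (\int[m']_x ((h \_ `]a, b[) x))%E; last first.
  by apply: eq_measure_integral => A mA _; rewrite m'A; exact: lebesgue_measureN.
rewrite m'I; first last.
- by move=> x; rewrite patchE; case: ifP.
- by apply/(measurable_restrictT _ mI)/measurable_funTS.
rewrite [LHS]integral_mkcond; apply: eq_integral => x _; rewrite !patchE.
by rewrite !mem_setE !in_itv/= ltrNl ltrNr andbC.
Qed.

(** The left side is the right side of the reflected measure. The two positivity clauses remember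
    that layers stay where [mu] has mass, which will place their endpoints in the closure of [X]. *)
Lemma unimodal_layers (R : realType) (a : R) (mu : probability (measurableTypeR R) R) :
  unimodal a mu -> exists zl zr : R -> R,
    [/\ measurable_fun setT zl /\ measurable_fun setT zr, forall y, zl y <= a <= zr y,
      forall y c d, a < c -> c < d -> d < zr y -> (0 < mu `]c, d]%classic)%E,
      forall y c d, zl y < c -> c < d -> d < a -> (0 < mu `]c, d]%classic)%E &
      forall h : R -> \bar R, measurable_fun (setT : set R) h -> (forall x, 0 <= h x)%E ->
        (\int[mu]_x h x = mu [set a] * h a +
          (\int[lebesgue_measure]_y \int[lebesgue_measure]_(x in `]zl y, a[%classic) h x +
           \int[lebesgue_measure]_y \int[lebesgue_measure]_(x in `]a, zr y[%classic) h x))%E].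
Proof.
move=> [Fl Fr]; set F := distribution_function mu in Fl Fr.
have mufin A : measurable A -> mu A \is a fin_num by exact: fin_num_measure.
have muF c d : c < d -> mu `]c, d]%classic = (F d - F c)%:E.
  move=> cd; have -> : `]c, d]%classic = `]-oo, d] `\` `]-oo, c] :> set R.
    by rewrite -[RHS]setCK setCD setCitvl setUC -[LHS]setCK setCitv.
  rewrite measureD//; last by rewrite -ge0_fin_numE//; exact: mufin.
  rewrite setIidr; last by apply: subset_itvl; rewrite bnd_simp ltW.
  by rewrite EFinB /F /distribution_function !fineK// mufin.
have [D Dslope] := concave_slopes Fr.
have muT : (mu setT < +oo)%E by rewrite -ge0_fin_numE// mufin.
have [] := @half_line_layers R mu a D muT.
  move=> c d ac cd; have /andP[h1 h2] := Dslope c d ac cd.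
  by have /= -> := muF c d cd; rewrite !lee_fin.
move=> zr [mzr azr zr_pos zrE].
(* Up to an additive constant and the side of half-open intervals, this is the distribution function
   of the reflected measure; convexity of [F] left of [a] becomes concavity right of [- a]. *)
pose F' x := - F (- x).
have /concave_slopes[D' D'slope] : @convex_function R R^o [set` `]- a, +oo[] (\- F').
  apply/convex_functionP => x y t; rewrite /= !in_itv/= !andbT => ax ay t01.
  have /convex_functionP/(_ (- x) (- y) t) := Fl; rewrite /= !in_itv/= !(ltrNl _ a).
  move=> /(_ ax ay t01); rewrite /F' !opprK.
  by have -> : - (t * x + (1 - t) * y) = t * - x + (1 - t) * - y by ring.
(* Reflection turns []c, d]] into an interval closed on the left, so atoms must be excluded. The
   slope bound controls the mass of []x - e / K, x]]; the 1 in [K] keeps the denominator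
   positive. *)
have atom0 x : x < a -> mu [set x] = 0%E.
  move=> xa; apply/eqP; rewrite eq_le measure_ge0 andbT; apply/lee_addgt0Pr => e e0.
  rewrite add0e; pose K := `|D' (- x)| + 1.
  have K0 : 0 < K by rewrite ltr_wpDl.
  have eK : 0 < e / K by rewrite divr_gt0.
  apply: (@le_trans _ _ (mu `](x - e / K), x]%classic)).
    apply: le_measure; rewrite ?inE// => _ ->; rewrite /= in_itv/= lexx andbT.
    by rewrite ltrBlDr ltrDl.
  rewrite muF ?lee_fin; last by rewrite ltrBlDr ltrDl.
  have /andP[_] := D'slope (- x) (- (x - e / K)) ltac:(lra) ltac:(lra).
  rewrite /F' !opprK opprB => h.
  have : D' (- x) * (e / K) <= e.
    rewrite mulrA ler_pdivrMr// mulrC ler_pM2l//.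
    by rewrite (le_trans (ler_norm _))// lerDl.
  by rewrite (_ : e / K - x + x = e / K) in h; [lra|ring].
have co_oc c d : c < d -> d < a -> mu `[c, d[%classic = mu `]c, d]%classic.
  move=> cd da; transitivity (mu `[c, d]%classic).
    rewrite -(@setUitv1 _ _ (BLeft c) d true); last by rewrite bnd_simp ltW.
    rewrite [RHS](measureU mu)//; last first.
      by apply/seteqP; split => // x /=; rewrite in_itv/= => -[/andP[_ +] xc]; rewrite xc ltxx.
    by rewrite [X in (_ + X)%E]atom0// adde0.
  rewrite -(@setU1itv _ _ (BRight d) c false); last by rewrite bnd_simp ltW.
  rewrite [LHS](measureU mu)//; last first.
    by apply/seteqP; split => // x /=; rewrite in_itv/= => -[-> /andP[]]; rewrite ltxx.
  by rewrite [X in (X + _)%E]atom0 ?add0e// (lt_trans cd).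
have [m' m'A m'I] :=
  @pushforward_measureP _ _ (measurableTypeR R) (measurableTypeR R) R mu -%R
    (@oppr_measurable R setT).
have m'T : (m' setT < +oo)%E by rewrite m'A preimage_setT.
have [] := @half_line_layers R m' (- a) D' m'T.
  move=> c d ac cd.
  have -> : m' `]c, d]%classic = (F' d - F' c)%:E.
    rewrite m'A opp_preimage_itvbndbnd/= /F' opprK addrC -muF ?ltrN2//.
    by rewrite co_oc ?ltrN2// ltrNl.
  rewrite !lee_fin; split.
    by have /andP[] := D'slope c d ac cd.
  by have /andP[] := D'slope c d ac cd.
move=> zl [mzl azl zl_pos zlE].
exists (fun y => - zl y), zr; split.
- by split => //; exact: measurable_funN.
- by move=> y; rewrite azr lerNl azl.
- exact: zr_pos.
- move=> y c d zc cd da.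
  have := zl_pos y (- d) (- c); rewrite !ltrN2 => /(_ da cd).
  by rewrite ltrNl => /(_ zc); rewrite m'A opp_preimage_itvbndbnd/= !opprK co_oc.
- move=> h mh h0; have mI : measurable (`]-oo, a[%classic : set (measurableTypeR R)) by [].
  have mI' : measurable (`](- a), +oo[%classic : set (measurableTypeR R)) by [].
  have mhN : measurable_fun (setT : set R) (fun x => h (- x)).
    by apply: measurableT_comp => //; exact: oppr_measurable.
  have -> : (\int[mu]_x h x = mu [set a] * h a +
      (\int[mu]_(x in `]-oo, a[%classic) h x + \int[mu]_(x in `]a, +oo[%classic) h x))%E.
    have -> : [set: R] = [set a] `|` (`]-oo, a[ `|` `]a, +oo[).
      apply/seteqP; split => // x _ /=; rewrite !in_itv/= andbT.
      by have [xa|xa|xa] := ltgtP x a; [right; left|right; right|left].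
    rewrite ge0_integral_setU//=; first last.
    - apply/disj_setPLR.
      by move=> x /= -> []; rewrite in_itv/= ltxx.
    - exact: measurable_funTS.
    - exact: measurableU.
    rewrite ge0_integral_setU//=; first last.
    - apply/disj_setPLR => x /=; rewrite !in_itv/= andbT => xa ax.
      by have := lt_trans xa ax; rewrite ltxx.
    - exact: measurable_funTS.
    congr (_ + _)%E; rewrite (eq_integral (fun=> h a)); last first.
      by move=> x; rewrite inE => ->.
    by rewrite integral_cst// muleC.
  rewrite (zrE h mh h0); congr (_ + (_ + _))%E.
  transitivity (\int[m']_(x in `](- a)%R, +oo[%classic) h (- x)%R)%E.
    rewrite [RHS]integral_mkcond m'I; first last.
    - by move=> x; rewrite patchE; case: ifP.
    - by apply/(measurable_restrictT _ mI')/measurable_funTS.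
    rewrite [LHS]integral_mkcond; apply: eq_integral => x _; rewrite !patchE !mem_setE.
    by rewrite !in_itv/= andbT ltrN2 opprK.
  rewrite (zlE _ mhN (fun x => h0 (- x))); apply: eq_integral => y _.
  by rewrite -[zl y]opprK ge0_integral_oppr// opprK.
Qed.

(** * Uniform measures on segments *)

Definition segment (R : realType) (a z : R) : set R :=
  `](Num.min a z), (Num.max a z)[%classic.

(** The integral of [h] against the uniform measure on $\mathrm{co}(a,z)$, the Dirac mass at [a]
    when [z = a]. The open segment suffices, its endpoints being Lebesgue null. *)
Definition segment_mean (R : realType) (a : R) (h : R -> \bar R) (z : R) : \bar R :=
  if z == a then h a
  else ((`|z - a|^-1)%:E * \int[lebesgue_measure]_(x in segment a z) h x)%E.

(** Makes every real parameter an admissible endpoint: those outside the closure of [X] fall back on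
    the Dirac mass at [a]. *)
Definition clamp (R : realType) (X : set R) (a z : R) : R :=
  if z \in closure X then z else a.

Lemma segmentR (R : realType) (a z : R) : a < z -> segment a z = `]a, z[%classic.
Proof. by move=> az; rewrite /segment min_l ?max_r// ltW. Qed.

Lemma segmentL (R : realType) (a z : R) : z < a -> segment a z = `]z, a[%classic.
Proof. by move=> za; rewrite /segment min_r ?max_l// ltW. Qed.

Lemma measurable_segment (R : realType) (a z : R) :
  measurable (segment a z : set (measurableTypeR R)).
Proof. exact: measurable_itv. Qed.

Lemma lebesgue_measure_segment (R : realType) (a z : R) :
  lebesgue_measure (segment a z) = (`|z - a|)%:E.
Proof.
rewrite /segment lebesgue_measure_itv/= lte_fin -EFinD.
have [az|za|->] := ltgtP a z; last by rewrite ltxx subrr normr0.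
- by rewrite az gtr0_norm ?subr_gt0.
- by rewrite za ltr0_norm ?subr_lt0// opprB.
Qed.

(** Even if [z] is only a limit of points of [X], some point of [X] lies beyond any given point of
    the open segment. *)
Lemma segment_sub (R : realType) (X : set R) (a z : R) :
  is_interval X -> X a -> closure X z -> segment a z `<=` X.
Proof.
move=> itvX Xa Xz x; rewrite /segment /= in_itv/= => /andP[].
have [az|za|->] := ltgtP a z.
- move=> ax xz; have /Xz[p [Xp /=]] : nbhs z `]x, +oo[%classic.
    by apply: open_nbhs_nbhs; split; [exact: interval_open|rewrite /= in_itv/= andbT].
  by rewrite in_itv/= andbT => xp; apply: (itvX a p); rewrite // !ltW.
- move=> zx xa; have /Xz[p [Xp /=]] : nbhs z `]-oo, x[%classic.
    by apply: open_nbhs_nbhs; split; [exact: interval_open|rewrite /= in_itv/=].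
  by rewrite in_itv/= => px; apply: (itvX p a); rewrite // !ltW.
- by move=> h1 h2; have := lt_trans h1 h2; rewrite ltxx.
Qed.

Lemma closure_clamp (R : realType) (X : set R) (a z : R) :
  X a -> closure X (clamp X a z).
Proof.
move=> Xa; rewrite /clamp; case: ifPn => [/set_mem//|_].
exact: subset_closure.
Qed.

Lemma measurable_clamp (R : realType) (X : set R) (a : R) :
  measurable_fun setT (clamp X a).
Proof.
apply: measurable_fun_ifT => //; apply: measurable_fun_in_set.
apply: closed_measurable; exact: closed_closure.
Qed.

Lemma segment_mean_indic (R : realType) (X : set R) (a z : R) :
  X a -> segment a z `<=` X ->
  segment_mean a (fun x => (\1_X x)%:E) z = 1%E.
Proof.
move=> Xa sX; rewrite /segment_mean; have [za|za] := eqVneq z a.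
  by rewrite indicE mem_set.
rewrite (eq_integral (cst 1%E)); last first.
  by move=> x; rewrite inE => /sX Xx; rewrite indicE mem_set.
rewrite integral_cst/= ?mul1e; last exact: measurable_segment.
by rewrite lebesgue_measure_segment -EFinM mulVf// normr_eq0 subr_eq0.
Qed.

Lemma exists_uniform_prob (R : realType) (X : set R) (a z : R) :
  is_interval X -> X a ->
  exists u : prob_on X, uniform_at a u /\
    forall h : R -> \bar R, measurable_fun (setT : set R) h -> (forall x, 0 <= h x)%E ->
      (\int[u]_x h x = segment_mean a h (clamp X a z))%E.
Proof.
move=> itvX Xa; have mX : measurable (X : set (measurableTypeR R)).
  exact: is_interval_measurable.
have := @closure_clamp R X a z Xa; move: (clamp X a z) => {}z Xz.
have [az|za|za] := ltgtP a z; last first.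
- have full : (@dirac _ (measurableTypeR R) a R : probability (measurableTypeR R) R) X = 1%E.
    by rewrite /= diracE mem_set.
  exists (ProbOn full); split; first by exists z => //; apply: Or31; split.
  move=> h mh h0; rewrite /segment_mean -za eqxx /=.
  by rewrite integral_dirac// diracT mul1e.
- have int_unif (h : R -> \bar R) : measurable_fun (setT : set R) h ->
      (forall x, 0 <= h x)%E -> (\int[uniform_prob za]_x h x = segment_mean a h z)%E.
    move=> mh h0; rewrite integral_uniform// /segment_mean lt_eqF// segmentL//.
    rewrite ltr0_norm ?subr_lt0// opprB; congr (_ * _)%E.
    by rewrite integral_itv_bndoo//; exact: measurable_funTS.
  have full : (uniform_prob za : probability (measurableTypeR R) R) X = 1%E.
    rewrite -(setIT X) -integral_indic// int_unif//.
    - by apply: segment_mean_indic => //; exact: segment_sub.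
    - exact/measurable_EFinP/measurable_indic.
  exists (ProbOn full); split => //.
  by exists z => //; apply: Or33; exists za.
- have int_unif (h : R -> \bar R) : measurable_fun (setT : set R) h ->
      (forall x, 0 <= h x)%E -> (\int[uniform_prob az]_x h x = segment_mean a h z)%E.
    move=> mh h0; rewrite integral_uniform// /segment_mean gt_eqF// segmentR//.
    rewrite gtr0_norm ?subr_gt0//; congr (_ * _)%E.
    by rewrite integral_itv_bndoo//; exact: measurable_funTS.
  have full : (uniform_prob az : probability (measurableTypeR R) R) X = 1%E.
    rewrite -(setIT X) -integral_indic// int_unif//.
    - by apply: segment_mean_indic => //; exact: segment_sub.
    - exact/measurable_EFinP/measurable_indic.
  exists (ProbOn full); split => //.
  by exists z => //; apply: Or32; exists az.
Qed.

Lemma measurable_segment_mean (R : realType) (a : R) (h : R -> \bar R) :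
  measurable_fun (setT : set R) h -> (forall x, 0 <= h x)%E ->
  measurable_fun (setT : set R) (segment_mean a h).
Proof.
move=> mh h0; apply: measurable_fun_ifT => //.
  exact: measurable_fun_eqr.
apply: emeasurable_funM.
  apply/measurable_EFinP; apply: measurable_fun_invr.
  by apply: measurableT_comp => //; exact: measurable_funB.
(* As a function of both the endpoint and the integration variable this is jointly measurable, so
   Tonelli gives measurability in [z]. *)
pose f (zx : measurableTypeR R * measurableTypeR R) :=
  if (Num.min a zx.1 < zx.2) && (zx.2 < Num.max a zx.1) then h zx.2 else 0%E.
have mf : measurable_fun setT f.
  apply: measurable_fun_ifT => //.
  - apply: measurable_and; apply: measurable_fun_ltr => //; try exact: measurable_snd.
      by apply: measurable_minr; [exact: measurable_cst|exact: measurable_fst].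
    by apply: measurable_maxr; [exact: measurable_cst|exact: measurable_fst].
  - by apply: measurableT_comp => //; exact: measurable_snd.
have f0 x : (0 <= f x)%E by rewrite /f; case: ifP.
have := @measurable_fun_fubini_tonelli_F _ _ (measurableTypeR R) (measurableTypeR R) R
  (@lebesgue_measure R) f mf f0.
congr (measurable_fun _ _); apply/funext => z; rewrite /fubini_F.
rewrite [RHS]integral_mkcond; apply: eq_integral => x _.
by rewrite /f patchE /= mem_setE in_itv.
Qed.

Lemma le_integral_segment (R : realType) (a z M : R) (h : R -> \bar R) :
  measurable_fun (setT : set R) h -> (forall x, 0 <= h x <= M%:E)%E ->
  (\int[lebesgue_measure]_(x in segment a z) h x <= (M * `|z - a|)%:E)%E.
Proof.
move=> mh hM; have M0 : (0 <= M%:E)%E by case/andP: (hM 0) => /le_trans; apply.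
apply: (@le_trans _ _ (\int[lebesgue_measure]_(x in segment a z) M%:E)%E).
  apply: ge0_le_integral => //.
  - exact: measurable_segment.
  - by move=> x _; case/andP: (hM x).
  - exact: measurable_funTS.
  - by move=> x _; case/andP: (hM x).
by rewrite integral_cst/= ?lebesgue_measure_segment//; exact: measurable_segment.
Qed.

Lemma segment_mean_oppr (R : realType) (a z : R) (h : R -> \bar R) :
  measurable_fun (setT : set R) h -> (forall x, 0 <= h x)%E ->
  segment_mean (- a) (fun x => h (- x)) (- z) = segment_mean a h z.
Proof.
move=> mh h0; rewrite /segment_mean eqr_opp -[- z - - a]opprD normrN opprK.
case: eqP => // _; congr (_ * _)%E.
rewrite /segment -oppr_max -oppr_min; exact: ge0_integral_oppr.
Qed.

Lemma fin_num_integral_segment (R : realType) (a z M : R) (h : R -> \bar R) :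
  measurable_fun (setT : set R) h -> (forall x, 0 <= h x <= M%:E)%E ->
  (\int[lebesgue_measure]_(x in segment a z) h x)%E \is a fin_num.
Proof.
move=> mh hM; rewrite ge0_fin_numE; last first.
  by apply: integral_ge0 => x _; case/andP: (hM x).
by apply: le_lt_trans (le_integral_segment _ _ mh hM) _; rewrite ltry.
Qed.

Lemma fine_segment_mean (R : realType) (a z M : R) (h : R -> \bar R) :
  measurable_fun (setT : set R) h -> (forall x, 0 <= h x <= M%:E)%E -> z != a ->
  fine (segment_mean a h z) =
    `|z - a|^-1 * fine (\int[lebesgue_measure]_(x in segment a z) h x)%E.
Proof.
move=> mh hM /negbTE za; rewrite /segment_mean za fineM//.
exact: fin_num_integral_segment mh hM.
Qed.

Lemma le_fine_integral_segment (R : realType) (a z M : R) (h : R -> \bar R) :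
  measurable_fun (setT : set R) h -> (forall x, 0 <= h x <= M%:E)%E ->
  0 <= fine (\int[lebesgue_measure]_(x in segment a z) h x)%E <= M * `|z - a|.
Proof.
move=> mh hM; rewrite fine_ge0/=; last first.
  by apply: integral_ge0 => x _; case/andP: (hM x).
rewrite -lee_fin fineK; first exact: le_integral_segment.
exact: fin_num_integral_segment mh hM.
Qed.

Lemma fine_integral_segmentB (R : realType) (a z z' M : R) (h : R -> \bar R) :
  measurable_fun (setT : set R) h -> (forall x, 0 <= h x <= M%:E)%E ->
  a < z -> z <= z' ->
  `|fine (\int[lebesgue_measure]_(x in segment a z') h x)%E -
    fine (\int[lebesgue_measure]_(x in segment a z) h x)%E| <= M * (z' - z).
Proof.
move=> mh hM az; rewrite le_eqVlt => /predU1P[<-|zz'].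
  by rewrite !subrr normr0 mulr0.
have az' := lt_trans az zz'.
have -> : (\int[lebesgue_measure]_(x in segment a z') h x =
    \int[lebesgue_measure]_(x in segment a z) h x +
    \int[lebesgue_measure]_(x in segment z z') h x)%E.
  rewrite !segmentR// (@itv_bndbnd_setU _ _ (BRight a) (BLeft z) (BLeft z')); last 2 first.
  - by rewrite bnd_simp.
  - by rewrite bnd_simp ltW.
  rewrite ge0_integral_setU//=; first last.
  - apply/disj_setPLR => x /=; rewrite !in_itv/= => /andP[_ xz] /andP[zx _].
    by have := lt_le_trans xz zx; rewrite ltxx.
  - by move=> x _; case/andP: (hM x).
  - exact: measurable_funTS.
  by congr (_ + _)%E; rewrite integral_itv_bndoo//; exact: measurable_funTS.
rewrite fineD; [|exact: fin_num_integral_segment mh hM..].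
have /andP[h1 h2] := @le_fine_integral_segment R z z' M h mh hM.
rewrite addrAC subrr add0r ger0_norm//.
by move: h2; rewrite gtr0_norm// subr_gt0.
Qed.

(** Both the length and the integral vary continuously with [z], and the length stays away from 0 as
    long as [z != a]. At [a] itself continuity can fail, [h] being only measurable. *)
Lemma segment_mean_continuous (R : realType) (a z M e : R) (h : R -> \bar R) :
  measurable_fun (setT : set R) h -> (forall x, 0 <= h x <= M%:E)%E ->
  z != a -> 0 < e ->
  exists2 del, 0 < del & forall z', `|z' - z| < del ->
    `|fine (segment_mean a h z') - fine (segment_mean a h z)| < e.
Proof.
wlog az : a z h / a < z => [hwlog mh hM za e0|].
  have [az|az] := ltP a z; first exact: hwlog.
  have {}az : - a < - z by rewrite ltrN2 lt_neqAle za.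
  have mhN : measurable_fun (setT : set R) (fun x => h (- x)).
    by apply: measurableT_comp => //; exact: oppr_measurable.
  have [] := hwlog _ _ _ az mhN (fun x => hM (- x)).
  - by rewrite eqr_opp.
  - by [].
  move=> del del0 H; exists del => // z' zz'.
  have h0 x : (0 <= h x)%E by case/andP: (hM x).
  rewrite -(segment_mean_oppr _ z' mh h0) -(segment_mean_oppr _ z mh h0).
  by apply: H; rewrite -opprD normrN.
move=> mh hM za e0.
have M0 : 0 <= M by rewrite -lee_fin; case/andP: (hM 0) => /le_trans; apply.
have p0 : 0 < z - a by rewrite subr_gt0.
(* The first bound keeps [z'] on the same side with [z' - a] above half of [z - a]. The error is at
   most [2 * M * |z' - z|] over [z' - a], whence the factor 4; the added 4 keeps the denominator
   positive if [M = 0]. *)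
pose del := Num.min ((z - a) / 2) (e * (z - a) / (4 * M + 4)).
have M4 : 0 < 4 * M + 4 by lra.
exists del; first by rewrite lt_min divr_gt0//= divr_gt0// mulr_gt0.
move=> z'; rewrite lt_min => /andP[zz1 zz2].
have p'2 : (z - a) / 2 < z' - a.
  by move: zz1; rewrite ltr_distl => /andP[]; lra.
have p'0 : 0 < z' - a by apply: lt_trans p'2; rewrite divr_gt0.
have az' : a < z' by rewrite -subr_gt0.
rewrite !(fine_segment_mean mh hM) ?gt_eqF// (gtr0_norm p0) (gtr0_norm p'0).
have /andP[A0 AM] := @le_fine_integral_segment R a z M h mh hM.
have AA : `|fine (\int[lebesgue_measure]_(x in segment a z') h x)%E -
    fine (\int[lebesgue_measure]_(x in segment a z) h x)%E| <= M * `|z' - z|.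
  have [zz'|z'z] := leP z z'.
    by rewrite (ger0_norm (x := z' - z)) ?subr_ge0//; exact: fine_integral_segmentB.
  rewrite distrC [X in _ <= M * X]distrC (gtr0_norm (x := z - z')) ?subr_gt0//.
  by apply: fine_integral_segmentB => //; exact: ltW.
move: A0 AM AA; rewrite (gtr0_norm p0).
move: (fine _) (fine _) => A A' A0 AM AA.
(* Separates the change of the integral from the change of the length; each contributes at most
   [M * |z' - z|]. *)
have -> : (z' - a)^-1 * A - (z - a)^-1 * A' =
    ((A - A') - A' / (z - a) * (z' - z)) / (z' - a).
  by field; rewrite !gt_eqF.
rewrite normrM normfV (gtr0_norm p'0) ltr_pdivrMr//.
have B1 : A' / (z - a) <= M by rewrite ler_pdivrMr.
have B0 : 0 <= A' / (z - a) by rewrite divr_ge0// ltW.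
apply: le_lt_trans (ler_normB _ _) _.
rewrite [X in _ + X]normrM (ger0_norm B0).
apply: (@le_lt_trans _ _ (2 * (M * `|z' - z|))).
  by rewrite mulr2n mulrDl mul1r lerD// ler_wpM2r.
have : (M + 1) * `|z' - z| < e * (z - a) / 4.
  move: zz2; rewrite ltr_pdivlMr// => zz2; lra.
have := normr_ge0 (z' - z).
have : e * ((z - a) / 2) < e * (z' - a) by rewrite ltr_pM2l.
lra.
Qed.

Section unimodal_mixture.
Variables (R : realType) (a : R).

Let below (x : R) : R -> \bar R := fun t => (\1_(`]-oo, x]%classic : set R) t)%:E.

Let integral_below (x z : R) :
  (\int[lebesgue_measure]_(t in segment a z) below x t =
   lebesgue_measure (`]-oo, x]%classic `&` segment a z))%E.
Proof. by rewrite /below integral_indic//; exact: measurable_segment. Qed.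

Lemma segment_mean_below_right (x z : R) : a < x ->
  fine (segment_mean a (below x) z) = if a < z then (Num.min x z - a) / (z - a) else 1.
Proof.
move=> ax; rewrite /segment_mean integral_below.
have [az|za|_] := ltgtP a z.
- rewrite segmentR// gtr0_norm ?subr_gt0//.
  have [xz|zx] := ltP x z.
    rewrite (_ : _ `&` _ = `]a, x]%classic).
      by rewrite lebesgue_measure_itv/= lte_fin ax -EFinB -EFinM/= mulrC.
    apply/seteqP; split => t /=; rewrite !in_itv/=.
      by move=> [-> /andP[->]].
    by move=> /andP[-> tx]; rewrite tx (le_lt_trans tx).
  rewrite setIidr; last first.
    by move=> t /=; rewrite !in_itv/= => /andP[_ tz]; rewrite (le_trans (ltW tz)).
  by rewrite lebesgue_measure_itv/= lte_fin az -EFinB -EFinM/= mulrC.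
- rewrite setIidr ?lebesgue_measure_segment//.
    by rewrite -EFinM/= mulVf// normr_eq0 subr_eq0 lt_eqF.
  move=> t; rewrite segmentL//= !in_itv/= => /andP[_ ta].
  by rewrite (le_trans (ltW ta))// ltW.
- by rewrite /below indicE mem_set//=; rewrite in_itv/= ltW.
Qed.

Lemma segment_mean_below_left (x z : R) : x < a ->
  fine (segment_mean a (below x) z) = if z < a then (Num.max x z - z) / (a - z) else 0.
Proof.
move=> xa; rewrite /segment_mean integral_below.
have [za|az|_] := ltgtP z a.
- rewrite segmentL// ltr0_norm ?subr_lt0// opprB.
  have [xz|zx] := ltP x z.
    rewrite (_ : _ `&` _ = set0) ?measure0 ?mule0 ?subrr ?mul0r//.
    apply/seteqP; split => // t /=; rewrite !in_itv/= => -[tx /andP[zt _]].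
    by have := lt_trans (lt_le_trans zt tx) xz; rewrite ltxx.
  rewrite (_ : _ `&` _ = `]z, x]%classic).
    rewrite lebesgue_measure_itv/= lte_fin; case: ltP => [_|xz].
      by rewrite -EFinB -EFinM/= mulrC.
    by rewrite mule0/= (_ : x = z) ?subrr ?mul0r//; apply/le_anti; rewrite xz.
  apply/seteqP; split => t /=; rewrite !in_itv/=.
    by move=> [-> /andP[->]].
  by move=> /andP[-> tx]; rewrite tx (le_lt_trans tx).
- rewrite (_ : _ `&` _ = set0) ?measure0 ?mule0//.
  rewrite segmentR//; apply/seteqP; split => // t /=; rewrite !in_itv/= => -[tx /andP[at_ _]].
  by have := lt_trans (lt_le_trans at_ tx) xa; rewrite ltxx.
- by rewrite /below indicE memNset//= in_itv/= leNgt xa.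
Qed.

(** As a function of [x], each uniform distribution function is constant or increasing affine in
    [Num.max x z] left of [a], hence convex, and in [Num.min x z] right of [a], hence concave.
    Nonnegative combinations keep both properties. *)
Lemma unimodal_mixture (v : probability (measurableTypeR R) R) (N : nat)
    (w z : 'I_N -> R) :
  (forall j, 0 <= w j) ->
  (forall x, distribution_function v x =
     \sum_j w j * fine (segment_mean a (fun t => (\1_(`]-oo, x]%classic : set R) t)%:E) (z j))) ->
  unimodal a v.
Proof.
move=> w0 vE; split; apply/convex_functionP => x y t; rewrite /= !in_itv/= ?andbT.
- move=> xa ya /andP[t0 t1].
  have ma : t * x + (1 - t) * y < a.
    have [->|tn0] := eqVneq t 0; first by rewrite mul0r add0r subr0 mul1r.
    have tp : 0 < t by rewrite lt_neqAle eq_sym tn0.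
    have : t * x < t * a by rewrite ltr_pM2l.
    have : (1 - t) * y <= (1 - t) * a by rewrite ler_wpM2l ?subr_ge0// ltW.
    lra.
  rewrite !vE !mulr_sumr -big_split/=; apply: ler_sum => j _.
  rewrite !segment_mean_below_left//; case: ifP => [za|_]; last lra.
  rewrite [X in _ <= X + _]mulrCA [X in _ <= _ + X]mulrCA -mulrDr ler_wpM2l//.
  rewrite [X in _ <= X + _]mulrA [X in _ <= _ + X]mulrA -mulrDl.
  rewrite ler_wpM2r ?invr_ge0 ?subr_ge0 ?(ltW za)//.
  have : Num.max (t * x + (1 - t) * y) (z j) <=
      t * Num.max x (z j) + (1 - t) * Num.max y (z j).
    have x1 : t * x <= t * Num.max x (z j) by rewrite ler_wpM2l// le_max lexx.
    have x2 : t * z j <= t * Num.max x (z j) by rewrite ler_wpM2l// le_max lexx orbT.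
    have y1 : (1 - t) * y <= (1 - t) * Num.max y (z j).
      by rewrite ler_wpM2l ?subr_ge0// le_max lexx.
    have y2 : (1 - t) * z j <= (1 - t) * Num.max y (z j).
      by rewrite ler_wpM2l ?subr_ge0// le_max lexx orbT.
    by rewrite ge_max; apply/andP; split; lra.
  lra.
- move=> xa ya /andP[t0 t1].
  have ma : a < t * x + (1 - t) * y.
    have [->|tn0] := eqVneq t 0; first by rewrite mul0r add0r subr0 mul1r.
    have tp : 0 < t by rewrite lt_neqAle eq_sym tn0.
    have : t * a < t * x by rewrite ltr_pM2l.
    have : (1 - t) * a <= (1 - t) * y by rewrite ler_wpM2l ?subr_ge0// ltW.
    lra.
  rewrite !mulrN -opprD lerN2.
  rewrite !vE !mulr_sumr -big_split/=; apply: ler_sum => j _.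
  rewrite !segment_mean_below_right//; case: ifP => [za|_]; last lra.
  rewrite [X in X + _ <= _]mulrCA [X in _ + X <= _]mulrCA -mulrDr ler_wpM2l//.
  rewrite [X in X + _ <= _]mulrA [X in _ + X <= _]mulrA -mulrDl.
  rewrite ler_wpM2r ?invr_ge0 ?subr_ge0 ?(ltW za)//.
  have : t * Num.min x (z j) + (1 - t) * Num.min y (z j) <=
      Num.min (t * x + (1 - t) * y) (z j).
    have x1 : t * Num.min x (z j) <= t * x by rewrite ler_wpM2l// ge_min lexx.
    have x2 : t * Num.min x (z j) <= t * z j by rewrite ler_wpM2l// ge_min lexx orbT.
    have y1 : (1 - t) * Num.min y (z j) <= (1 - t) * y.
      by rewrite ler_wpM2l ?subr_ge0// ge_min lexx.
    have y2 : (1 - t) * Num.min y (z j) <= (1 - t) * z j.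
      by rewrite ler_wpM2l ?subr_ge0// ge_min lexx orbT.
    by rewrite le_min; apply/andP; split; lra.
  lra.
Qed.

End unimodal_mixture.

(** * Khinchine's representation by a law of the endpoint *)

Lemma probability_of_measure d (T : measurableType d) (R : realType)
    (m : {measure set T -> \bar R}) :
  m setT = 1%E -> exists p : probability T R, p = m :> (set T -> \bar R).
Proof.
(* A measure of mass 1 is its own normalisation, which comes bundled as a probability. *)
move=> mT; exists (mnormalize m (dirac point)).
apply/funext => A; rewrite /= /mnormalize mT.
by rewrite onee_eq0/= invr1 mule1.
Qed.

(** [X] has full mass, so every interval of positive mass meets it; such intervals exist arbitrarily
    close to [z] on the side of [a]. *)
Lemma closure_of_positive (R : realType) (X : set R) (mu : prob_on X) (a z : R) :
  measurable (X : set (measurableTypeR R)) -> X a ->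
  (forall c d, Num.min a z < c -> c < d -> d < Num.max a z ->
    (0 < mu `]c, d]%classic)%E) ->
  closure X z.
Proof.
move=> mX Xa pos; have meets c d : (0 < mu `]c, d]%classic)%E ->
    exists2 x, X x & c < x <= d.
  move=> cd0; apply/not_exists2P => h.
  have : (mu `]c, d]%classic <= mu (~` X))%E.
    apply: le_measure; rewrite ?inE//; first exact: measurableC.
    by move=> x /=; rewrite in_itv/= => xcd Xx; have [] := h x.
  rewrite probability_setC// prob_on_full subee// => /(lt_le_trans cd0).
  by rewrite ltxx.
move=> B /nbhs_ballP[e /= e0 eB].
have [az|za|az] := ltgtP a z; last first.
- by exists a; split => //; apply: eB; rewrite -az; exact: ballxx.
- pose r := Num.min (e / 2) ((a - z) / 2).
  have r0 : 0 < r by rewrite lt_min; apply/andP; split; lra.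
  have re : r <= e / 2 by rewrite ge_min lexx.
  have rz : r <= (a - z) / 2 by rewrite ge_min lexx orbT.
  have [|x Xx /andP[h1 h2]] := meets (z + r / 2) (z + r).
    by apply: pos; rewrite ?(min_r (ltW za)) ?(max_l (ltW za)); lra.
  exists x; split => //; apply: eB; rewrite /ball/= ltr_distl; apply/andP; split; lra.
- pose r := Num.min (e / 2) ((z - a) / 2).
  have r0 : 0 < r by rewrite lt_min; apply/andP; split; lra.
  have re : r <= e / 2 by rewrite ge_min lexx.
  have rz : r <= (z - a) / 2 by rewrite ge_min lexx orbT.
  have [|x Xx /andP[h1 h2]] := meets (z - r) (z - r / 2).
    by apply: pos; rewrite ?(min_l (ltW az)) ?(max_r (ltW az)); lra.
  exists x; split => //; apply: eB; rewrite /ball/= ltr_distl; apply/andP; split; lra.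
Qed.

Lemma khinchine (R : realType) (X : set R) (a : R) (mu : prob_on X) :
  is_interval X -> X a -> unimodal a mu ->
  exists P : probability (measurableTypeR R) R,
    forall h : R -> \bar R, measurable_fun (setT : set R) h -> (forall x, 0 <= h x)%E ->
      (\int[mu]_x h x = \int[P]_z segment_mean a h (clamp X a z))%E.
Proof.
move=> itvX Xa /unimodal_layers[zl [zr [[mzl mzr] azz posr posl muE]]].
have mX : measurable (X : set (measurableTypeR R)) by exact: is_interval_measurable.
have Xzr y : closure X (zr y).
  apply: (closure_of_positive mX Xa) => c d; have /andP[_ az] := azz y.
  by rewrite (min_l az) (max_r az); exact: posr.
have Xzl y : closure X (zl y).
  apply: (closure_of_positive mX Xa) => c d; have /andP[za _] := azz y.
  by rewrite (min_r za) (max_l za); exact: posl.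
(* The three sources of mass: the atom at [a], the left layers and the right layers, all
   parametrised by the level [y] under Lebesgue measure. *)
pose G (i : 'I_3) (y : R) : R :=
  match val i with 0 => a | 1 => zl y | _ => zr y end.
(* The atom is spread over the levels []0, 1]], of total length 1. The weight [|z - a|] of a layer
   cancels the normalisation inside [segment_mean]. *)
pose w (i : 'I_3) (y : R) : R :=
  if val i is 0 then fine (mu [set a]) * \1_(`]0, 1]%classic : set R) y
  else `|G i y - a|.
have mG i : measurable_fun (setT : set (measurableTypeR R)) (G i : _ -> measurableTypeR R).
  by case: i => [] [|[|i]] i3; rewrite /G /=; [exact: measurable_cst|exact: mzl|exact: mzr].
have mw i : measurable_fun (setT : set (measurableTypeR R)) (w i).
  case: i => [] [|i] /= i3.
    by apply: measurable_funM => //; exact: measurable_indic.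
  by apply: measurableT_comp => //; apply: measurable_funB => //; exact: mG.
have w0 i y : 0 <= w i y.
  by rewrite /w; case: (val i) => [|_]; rewrite ?normr_ge0// mulr_ge0// fine_ge0.
have sum3 (F : 'I_3 -> \bar R) : (\sum_i F i =
    F ord0 + (F (lift ord0 ord0) + F (lift ord0 (lift ord0 ord0))))%E.
  by rewrite !big_ord_recl big_ord0 adde0.
have [P PE] := weighted_pushforward (@lebesgue_measure R) mw w0 mG.
have layer (h : R -> \bar R) z : closure X z ->
    ((`|z - a|)%:E * segment_mean a h (clamp X a z) =
     \int[lebesgue_measure]_(x in segment a z) h x)%E.
  move=> Xz; rewrite /clamp mem_set// /segment_mean.
  have [->|za] := eqVneq z a.
    by rewrite subrr normr0 mul0e /segment minxx maxxx set_itvoo0 integral_set0.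
  by rewrite muleA -EFinM mulfV ?mul1e// normr_eq0 subr_eq0.
have muP h : measurable_fun (setT : set R) h -> (forall x, 0 <= h x)%E ->
    (\int[mu]_x h x = \int[P]_z segment_mean a h (clamp X a z))%E.
  move=> mh h0; rewrite (muE h mh h0) PE; last 2 first.
  - apply: (@measurableT_comp _ _ _ _ _ _ (segment_mean a h)).
      exact: measurable_segment_mean.
    exact: measurable_clamp.
  - move=> z; rewrite /segment_mean; case: ifP => // _.
    by rewrite mule_ge0// integral_ge0.
  rewrite sum3; congr (_ + (_ + _))%E.
  - rewrite /w /G /=; set k := segment_mean _ _ _.
    have -> : k = h a.
      have ca : clamp X a a = a by rewrite /clamp; case: ifP.
      by rewrite /k /segment_mean ca eqxx.
    have ha0 := h0 a.
    rewrite ge0_integralZr//; last 2 first.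
    - by apply/measurable_EFinP; apply: measurable_funM => //; exact: measurable_indic.
    - by move=> y _; rewrite lee_fin mulr_ge0// fine_ge0.
    congr (_ * _)%E; under eq_integral => y _ do rewrite EFinM.
    rewrite ge0_integralZl_EFin//; last 2 first.
    - by apply/measurable_EFinP; exact: measurable_indic.
    - exact: fine_ge0.
    rewrite integral_indic//= setIT lebesgue_measure_itv/= lte_fin ltr01.
    by rewrite oppr0 adde0 mule1 fineK// fin_num_measure.
  - apply: eq_integral => y _; rewrite /w /G /= layer//.
    by have /andP[za _] := azz y; rewrite /segment (min_r za) (max_l za).
  - apply: eq_integral => y _; rewrite /w /G /= layer//.
    by have /andP[_ az] := azz y; rewrite /segment (min_l az) (max_r az).
have PT : P setT = 1%E.
  have m1 : measurable_fun (setT : set R) (cst 1%E : R -> \bar R) by exact: measurable_cst.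
  have := muP _ m1 (fun=> lee01).
  rewrite (integral_cst _ (@measurableT _ (measurableTypeR R))) mul1e.
  move=> muPT; have := probability_setT (mu : probability (measurableTypeR R) R).
  rewrite [LHS]muPT => <-.
  rewrite (eq_integral (cst 1%E)) ?integral_cst ?mul1e// => z _ /=.
  rewrite /segment_mean; case: eqP => // /eqP za.
  rewrite integral_cst/= ?mul1e; last exact: measurable_segment.
  by rewrite lebesgue_measure_segment -EFinM mulVf// normr_eq0 subr_eq0.
have [p pE] := probability_of_measure PT.
by exists p => h mh h0; rewrite (muP h mh h0) pE.
Qed.

(** * Constrained mixtures of uniform measures *)

(** The [phi i] are measurable on [X] only, whereas the representations are tested on functions of
    the whole line; hence the extension by zero. *)
Definition off0 (R : realType) (X : set R) (f : R -> R) (x : R) : R :=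
  if x \in X then f x else 0.

Definition pos_part (R : realType) (X : set R) (f : R -> R) (x : R) : \bar R :=
  (Num.max (off0 X f x) 0)%:E.

Definition neg_part (R : realType) (X : set R) (f : R -> R) (x : R) : \bar R :=
  (Num.max (- off0 X f x) 0)%:E.

Definition abs_part (R : realType) (X : set R) (f : R -> R) (x : R) : \bar R :=
  `|off0 X f x|%:E.

Section parts.
Variables (R : realType) (X : set R) (mX : measurable (X : set (measurableTypeR R))).
Variables (f : R -> R) (mf : measurable_fun (X : set (measurableTypeR R)) f).

Lemma measurable_off0 : measurable_fun (setT : set (measurableTypeR R)) (off0 X f).
Proof.
have -> : off0 X f = f \_ X by apply/funext => x; rewrite patchE.
by apply/(measurable_restrictT _ mX).
Qed.

Lemma measurable_pos_part : measurable_fun (setT : set (measurableTypeR R)) (pos_part X f).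
Proof.
apply/measurable_EFinP; apply: measurable_maxr; last exact: measurable_cst.
exact: measurable_off0.
Qed.

Lemma measurable_neg_part : measurable_fun (setT : set (measurableTypeR R)) (neg_part X f).
Proof.
apply/measurable_EFinP; apply: measurable_maxr; last exact: measurable_cst.
by apply: measurable_funN; exact: measurable_off0.
Qed.

Lemma measurable_abs_part : measurable_fun (setT : set (measurableTypeR R)) (abs_part X f).
Proof.
by apply/measurable_EFinP; apply: measurableT_comp => //; exact: measurable_off0.
Qed.

Lemma pos_part_ge0 x : (0 <= pos_part X f x)%E.
Proof. by rewrite lee_fin le_max lexx orbT. Qed.

Lemma neg_part_ge0 x : (0 <= neg_part X f x)%E.
Proof. by rewrite lee_fin le_max lexx orbT. Qed.

Lemma abs_part_ge0 x : (0 <= abs_part X f x)%E.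
Proof. by rewrite lee_fin. Qed.

Lemma pos_part_le x : (pos_part X f x <= abs_part X f x)%E.
Proof. by rewrite lee_fin ge_max ler_norm normr_ge0. Qed.

Lemma neg_part_le x : (neg_part X f x <= abs_part X f x)%E.
Proof. by rewrite lee_fin ge_max -normrN ler_norm normr_ge0. Qed.

Lemma integral_parts (m : {measure set (measurableTypeR R) -> \bar R}) :
  (\int[m]_(x in X) (f x)%:E = \int[m]_x pos_part X f x - \int[m]_x neg_part X f x)%E.
Proof.
rewrite integral_mkcond integralE; congr (_ - _)%E; apply: eq_integral => x _.
  by rewrite funeposE patchE /pos_part /off0 EFin_max; case: ifP.
by rewrite funenegE patchE /neg_part /off0 EFin_max; case: ifP.
Qed.

Lemma integral_abs_part (m : {measure set (measurableTypeR R) -> \bar R}) :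
  (\int[m]_(x in X) `|(f x)%:E| = \int[m]_x abs_part X f x)%E.
Proof.
rewrite integral_mkcond; apply: eq_integral => x _.
by rewrite patchE /abs_part /off0; case: ifP => //; rewrite normr0.
Qed.

End parts.

Lemma segment_mean_ge0 (R : realType) (a : R) (h : R -> \bar R) (z : R) :
  (forall x, 0 <= h x)%E -> (0 <= segment_mean a h z)%E.
Proof.
move=> h0; rewrite /segment_mean; case: ifP => // _.
by rewrite mule_ge0 ?lee_fin ?invr_ge0// integral_ge0.
Qed.

Lemma le_segment_mean (R : realType) (a : R) (h k : R -> \bar R) (z : R) :
  measurable_fun (setT : set R) h -> measurable_fun (setT : set R) k ->
  (forall x, 0 <= h x)%E -> (forall x, h x <= k x)%E ->
  (segment_mean a h z <= segment_mean a k z)%E.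
Proof.
move=> mh mk h0 hk; rewrite /segment_mean; case: ifP => // _.
apply: lee_wpmul2l; first by rewrite lee_fin invr_ge0.
apply: ge0_le_integral => //; first exact: measurable_segment.
- exact: measurable_funTS.
- exact: measurable_funTS.
Qed.

Lemma fin_num_between (R : realType) (x y : \bar R) :
  (0 <= x)%E -> (x <= y)%E -> (y < +oo)%E -> x \is a fin_num.
Proof. by move=> x0 xy yoo; rewrite ge0_fin_numE// (le_lt_trans xy). Qed.

(** Integrability of [phi i] under [mu] gives a finite mean of its absolute value over almost every
    segment. Later steps need this for every parameter, so on the exceptional null set the endpoint
    becomes [a], where the mean is a point value. *)
Lemma constrained_khinchine (R : realType) (X : set R) (a : R) (n : nat)
    (phi : 'I_n -> R -> R) (mu : prob_on X) :
  is_interval X -> X a -> (forall i, measurable_fun X (phi i)) -> admissible a phi mu ->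
  exists (P : probability (measurableTypeR R) R) (c : R -> R),
    [/\ measurable_fun setT c, forall z, closure X (c z),
      forall i z, (segment_mean a (abs_part X (phi i)) (c z) < +oo)%E &
      forall h : R -> \bar R, measurable_fun (setT : set R) h -> (forall x, 0 <= h x)%E ->
        (\int[mu]_x h x = \int[P]_z segment_mean a h (c z))%E].
Proof.
move=> itvX Xa mphi [umu phimu].
have mX : measurable (X : set (measurableTypeR R)) by exact: is_interval_measurable.
have [P PE] := khinchine itvX Xa umu.
pose k i z := segment_mean a (abs_part X (phi i)) (clamp X a z).
have mab i := measurable_abs_part mX (mphi i).
have ab0 i := abs_part_ge0 X (phi i).
have mk i : measurable_fun (setT : set (measurableTypeR R)) (k i).
  apply: (measurableT_comp (f := segment_mean a (abs_part X (phi i)))).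
    by apply: measurable_segment_mean; [exact: mab|exact: ab0].
  exact: measurable_clamp.
have k0 i z : (0 <= k i z)%E by apply: segment_mean_ge0; exact: ab0.
have kfin i : (\int[P]_z k i z < +oo)%E.
  rewrite -PE; [|exact: mab|exact: ab0].
  by rewrite -integral_abs_part; have [/integrableP[]] := phimu i.
pose b z := [forall i, (k i z < +oo)%E].
have mb : measurable_fun (setT : set (measurableTypeR R)) b.
  apply: measurable_fun_forall => i; apply: (measurable_fun_bool true).
  rewrite setTI (_ : _ @^-1` _ = [set z | (k i z < +oo)%E]); last first.
    by apply/seteqP; split => z.
  by have := emeasurable_fun_infty_o measurableT (mk i) +oo%E; rewrite setTI.
exists P, (fun z => if b z then clamp X a z else a); split.
- apply: measurable_fun_ifT => //; first exact: measurable_clamp.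
- move=> z; case: ifP => _; first exact: closure_clamp.
  exact: subset_closure.
- move=> i z; case: ifPn => [/forallP/(_ i)//|_].
  by rewrite /segment_mean eqxx ltry.
- move=> h mh h0; rewrite (PE h mh h0).
  have msm : measurable_fun (setT : set (measurableTypeR R)) (segment_mean a h).
    exact: measurable_segment_mean.
  have mc : measurable_fun (setT : set (measurableTypeR R))
      (fun z => if b z then clamp X a z else a).
    apply: measurable_fun_ifT => //; exact: measurable_clamp.
  apply: ge0_ae_eq_integral => //.
  + by apply: (measurableT_comp msm); exact: measurable_clamp.
  + by apply: (measurableT_comp msm).
  + by move=> z _; exact: segment_mean_ge0.
  + by move=> z _; exact: segment_mean_ge0.
  have : {ae P, forall z, forall i, (k i z < +oo)%E}.
    apply: filter_forall => i.
    have : P.-integrable setT (k i).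
      apply/integrableP; split; first exact: mk.
      by under eq_integral => z _ do rewrite gee0_abs//.
    move=> /(integrable_ae measurableT); apply: filterS => z /= /(_ I).
    by rewrite ge0_fin_numE.
  have FF : Filter (nbhs (almost_everywhere P)) by exact: ae_filter_ringOfSetsType.
  apply: filterS => z /= kz _; rewrite /b.
  by have /forallP -> : forall i, (k i z < +oo)%E.
Qed.

(** The mean of [f] over $\mathrm{co}(a,z)$ as a real number; it has this meaning once the mean of
    [abs_part X f] is finite. *)
Definition segment_mean_part (R : realType) (X : set R) (a : R) (f : R -> R) (z : R) : R :=
  fine (segment_mean a (pos_part X f) z) - fine (segment_mean a (neg_part X f) z).

(** A constraint on [mu] is a moment constraint on the endpoint law [P], whose test function is the
    mean of [phi i] over the segment. Composing the atoms with [c] keeps their endpoints in the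
    closure of [X] and all means finite. *)
Lemma constrained_decomposition (R : realType) (X : set R) (a : R) (n : nat)
    (phi : 'I_n -> R -> R) (mu : prob_on X) :
  is_interval X -> X a -> (forall i, measurable_fun X (phi i)) -> admissible a phi mu ->
  exists d (T : measurableType d) (Q : probability T R) (I : finType)
      (w z : I -> 'I_n.+1 -> T -> R),
    [/\ forall p, @configuration _ _ _ (measurableTypeR R) R _ (w p) (z p),
      forall p j t, closure X (z p j t),
      forall i p j t, (segment_mean a (abs_part X (phi i)) (z p j t) < +oo)%E,
      forall p i t, \sum_j w p j t * segment_mean_part X a (phi i) (z p j t) <= 0 &
      forall h : R -> \bar R, measurable_fun (setT : set R) h -> (forall x, 0 <= h x)%E ->
        (\int[mu]_x h x =
         \sum_p \int[Q]_t @atoms_integral _ _ _ (measurableTypeR R) R _ (w p) (z p)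
           (segment_mean a h) t)%E].
Proof.
move=> itvX Xa mphi Amu.
have mX : measurable (X : set (measurableTypeR R)) by exact: is_interval_measurable.
have [P [c [mc Xc cab PE]]] := constrained_khinchine itvX Xa mphi Amu.
have msm (h : R -> \bar R) : measurable_fun (setT : set R) h -> (forall x, 0 <= h x)%E ->
    measurable_fun (setT : set (measurableTypeR R)) (fun z => segment_mean a h (c z)).
  move=> mh h0; apply: (measurableT_comp (f := segment_mean a h)) => //.
  exact: measurable_segment_mean.
have part (i : 'I_n) (h : R -> \bar R) : measurable_fun (setT : set R) h ->
    (forall x, 0 <= h x)%E -> (forall x, h x <= abs_part X (phi i) x)%E ->
    (forall z, segment_mean a h (c z) \is a fin_num) /\
    P.-integrable setT (fun z => segment_mean a h (c z)).
  move=> mh h0 hab.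
  have mab := measurable_abs_part mX (mphi i).
  have le z := le_segment_mean a (c z) mh mab h0 hab.
  have ge z : (0 <= segment_mean a h (c z))%E by exact: segment_mean_ge0.
  split; first by move=> z; apply: fin_num_between (ge z) (le z) (cab i z).
  apply/integrableP; split; first exact: msm.
  apply: (@le_lt_trans _ _ (\int[P]_z segment_mean a (abs_part X (phi i)) (c z))%E).
    apply: ge0_le_integral => //.
    - by apply: measurableT_comp => //; exact: msm.
    - by apply: msm => //; exact: abs_part_ge0.
    - by move=> z _; rewrite gee0_abs.
  rewrite -PE//; last exact: abs_part_ge0.
  rewrite -integral_abs_part; have [_ /(_ i)[/integrableP[]]] := Amu.
  by [].
have posP i := part i _ (measurable_pos_part mX (mphi i)) (pos_part_ge0 _ _) (pos_part_le _ _).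
have negP i := part i _ (measurable_neg_part mX (mphi i)) (neg_part_ge0 _ _) (neg_part_le _ _).
pose psi i z := segment_mean_part X a (phi i) (c z).
have psiE i : EFin \o psi i = (fun z => segment_mean a (pos_part X (phi i)) (c z) -
    segment_mean a (neg_part X (phi i)) (c z))%E.
  apply/funext => z; rewrite /= /psi /segment_mean_part EFinB.
  by rewrite (fineK ((posP i).1 z)) (fineK ((negP i).1 z)).
have mpsi i : measurable_fun (setT : set (measurableTypeR R)) (psi i).
  apply/measurable_EFinP; rewrite psiE; apply: emeasurable_funB.
    by apply: msm; [exact: (measurable_pos_part mX (mphi i))|exact: pos_part_ge0].
  by apply: msm; [exact: (measurable_neg_part mX (mphi i))|exact: neg_part_ge0].
have ipsi i : P.-integrable setT (EFin \o psi i).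
  by rewrite psiE; apply: integrableB => //; [exact: (posP i).2|exact: (negP i).2].
have psi_le0 i : (\int[P]_z (psi i z)%:E <= 0)%E.
  rewrite -[X in integral _ _ X]/(EFin \o psi i) psiE.
  rewrite integralB//; [|exact: (posP i).2|exact: (negP i).2].
  have e1 := PE _ (measurable_pos_part mX (mphi i)) (pos_part_ge0 _ _).
  have e2 := PE _ (measurable_neg_part mX (mphi i)) (neg_part_ge0 _ _).
  rewrite -e1 -e2 -integral_parts.
  by have [_ /(_ i)[]] := Amu.
have [d [T [Q [I [w [z [cwz wpsi wE]]]]]]] := moment_decomposition mpsi ipsi psi_le0.
exists d, T, Q, I, w, (fun p j t => c (z p j t)); split.
- move=> p; have [mw w0 mz] := cwz p; split => // j.
  exact: (measurableT_comp mc (mz j)).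
- by move=> p j t; exact: Xc.
- by move=> i p j t; exact: cab.
- by move=> p i t; exact: wpsi.
- move=> h mh h0; rewrite (PE h mh h0) (wE _ (msm h mh h0)); last first.
    by move=> z'; exact: segment_mean_ge0.
  by [].
Qed.

Lemma exists_mixture (R : realType) (X : set R) (N : nat) (w : 'I_N -> R)
    (u : 'I_N -> prob_on X) :
  (forall j, 0 <= w j) -> \sum_j w j = 1 ->
  exists v : prob_on X,
    (forall A : set R, measurable (A : set (measurableTypeR R)) ->
      v A = (\sum_j (w j)%:E * u j A)%E) /\
    forall h : R -> \bar R, measurable_fun (setT : set R) h -> (forall x, 0 <= h x)%E ->
      (\int[v]_x h x = \sum_j (w j)%:E * \int[u j]_x h x)%E.
Proof.
move=> w0 w1.
have [m mE] : exists m : {measure set (measurableTypeR R) -> \bar R},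
    (forall A, m A = (\sum_j (w j)%:E * u j A)%E) /\
    forall h : R -> \bar R, measurable_fun (setT : set R) h -> (forall x, 0 <= h x)%E ->
      (\int[m]_x h x = \sum_j (w j)%:E * \int[u j]_x h x)%E.
  elim: (index_enum 'I_N) => [|j s [m [mA mI]]].
    exists mzero; split => [A|h mh h0]; first by rewrite big_nil.
    by rewrite big_nil integral_measure_zero.
  exists (measure_add (mscale (NngNum (w0 j)) (u j)) m); split => [A|h mh h0].
    by rewrite big_cons -mA; exact: measure_addE.
  rewrite big_cons ge0_integral_measure_add//; congr (_ + _)%E; last exact: mI.
  by rewrite ge0_integral_mscale.
have [mA mI] := mE.
have mT : m setT = 1%E.
  rewrite mA (eq_bigr (fun j => (w j)%:E)) ?sumEFin ?w1// => j _.
  by rewrite probability_setT mule1.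
have [p pE] := probability_of_measure mT.
have full : p X = 1%E.
  rewrite pE mA (eq_bigr (fun j => (w j)%:E)) ?sumEFin ?w1// => j _.
  by rewrite prob_on_full mule1.
exists (ProbOn full); split => [A _|h mh h0] /=; first by rewrite pE mA.
by rewrite pE mI.
Qed.

Lemma exists_mixture_Delta (R : realType) (X : set R) (a : R) (n : nat)
    (phi : 'I_n -> R -> R) (w z : 'I_n.+1 -> R) :
  is_interval X -> X a -> (forall i, measurable_fun X (phi i)) ->
  (forall j, 0 <= w j) -> \sum_j w j = 1 -> (forall j, closure X (z j)) ->
  (forall i j, (segment_mean a (abs_part X (phi i)) (z j) < +oo)%E) ->
  (forall i, \sum_j w j * segment_mean_part X a (phi i) (z j) <= 0) ->
  exists v : prob_on X, Delta a phi v /\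
    forall h : R -> \bar R, measurable_fun (setT : set R) h -> (forall x, 0 <= h x)%E ->
      (\int[v]_x h x = \sum_j (w j)%:E * segment_mean a h (z j))%E.
Proof.
move=> itvX Xa mphi w0 w1 Xz zab wpsi.
have mX : measurable (X : set (measurableTypeR R)) by exact: is_interval_measurable.
have [u uP] := choice (fun j => @exists_uniform_prob R X a (z j) itvX Xa).
have uI j (h : R -> \bar R) : measurable_fun (setT : set R) h -> (forall x, 0 <= h x)%E ->
    (\int[u j]_x h x = segment_mean a h (z j))%E.
  by move=> mh h0; rewrite (uP j).2// /clamp mem_set.
have [v [vA vI]] := exists_mixture u w0 w1.
have vE (h : R -> \bar R) : measurable_fun (setT : set R) h -> (forall x, 0 <= h x)%E ->
    (\int[v]_x h x = \sum_j (w j)%:E * segment_mean a h (z j))%E.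
  by move=> mh h0; rewrite (vI h mh h0); apply: eq_bigr => j _; rewrite (uI j h mh h0).
exists v; split; last exact: vE.
have uv : unimodal a v.
  apply: (unimodal_mixture w0 (z := z)) => x.
  have mA : measurable (`]-oo, x]%classic : set (measurableTypeR R)) by [].
  rewrite /distribution_function vA// -sum_fine; last first.
    by move=> j _; rewrite fin_numM// fin_num_measure.
  apply: eq_bigr => j _; rewrite fineM//; last exact: fin_num_measure.
  congr (_ * fine _); rewrite -uI; last 2 first.
  - by apply/measurable_EFinP/measurable_indic.
  - by move=> t; rewrite lee_fin.
  by rewrite integral_indic// setIT.
have part i (h : R -> \bar R) : measurable_fun (setT : set R) h ->
    (forall x, 0 <= h x)%E -> (forall x, h x <= abs_part X (phi i) x)%E ->
    forall j, segment_mean a h (z j) \is a fin_num.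
  move=> mh h0 hab j; apply: fin_num_between (zab i j); first exact: segment_mean_ge0.
  exact: (le_segment_mean a (z j) mh (measurable_abs_part mX (mphi i)) h0 hab).
have posP i := part i _ (measurable_pos_part mX (mphi i)) (pos_part_ge0 _ _) (pos_part_le _ _).
have negP i := part i _ (measurable_neg_part mX (mphi i)) (neg_part_ge0 _ _) (neg_part_le _ _).
split; last by exists w, u; split => // j; exact: (uP j).1.
split => // i; split.
  apply/integrableP; split; first by apply/measurable_EFinP; exact: mphi.
  rewrite (integral_abs_part X (phi i)).
  rewrite (vE _ (measurable_abs_part mX (mphi i)) (abs_part_ge0 _ _)).
  by apply: lte_sum_pinfty => j _; apply: lte_mul_pinfty; rewrite ?lee_fin.
rewrite (integral_parts X (phi i)).
rewrite (vE _ (measurable_pos_part mX (mphi i)) (pos_part_ge0 _ _)).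
rewrite (vE _ (measurable_neg_part mX (mphi i)) (neg_part_ge0 _ _)).
have E (h : R -> \bar R) : (forall j, segment_mean a h (z j) \is a fin_num) ->
    (\sum_j (w j)%:E * segment_mean a h (z j) =
     (\sum_j w j * fine (segment_mean a h (z j)))%:E)%E.
  by move=> hf; rewrite -sumEFin; apply: eq_bigr => j _; rewrite EFinM fineK.
rewrite (E _ (posP i)) (E _ (negP i)) -EFinB lee_fin -sumrB.
by rewrite (le_trans _ (wpsi i))// ler_sum// => j _; rewrite -mulrBr.
Qed.

(** * Weak topology *)

Section weak_topology_prob.
Variables (R : realType) (X : set R).

(** The weak topology is initial for the pairings, so their convergence gives weak convergence. An
    arbitrary filter is allowed because the parameter space is a measurable space without a
    topology. *)
Lemma weak_open_near (T : Type) (F : set_system T) (FF : Filter F)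
    (G : T -> prob_on X) (v : prob_on X) (O : set (prob_on X)) :
  open O -> O v ->
  (forall f (Cf : Cb X f),
    (fun t => (\int[G t]_(x in X) f x)%R) @ F --> (\int[v]_(x in X) f x)%R) ->
  F (G @^-1` O).
Proof.
move=> [B oB <-] Bv Gv.
have : (fun t => pairing (G t)) @ F --> pairing v.
  apply/cvg_sup => i U [?/= [[W oW <-]]] /= Wv /filterS; apply.
  have := Gv (set_val i) (set_valP i).
  by apply; apply: open_nbhs_nbhs.
by apply; apply: open_nbhs_nbhs.
Qed.

Lemma open_pairing (D : set (prob_on X)) (f : R -> R) (C : set R) :
  Cb X f -> open C ->
  open [set s : set_type D | C (\int[(set_val s : prob_on X)]_(x in X) f x)%R].
Proof.
move=> Cf oC.
exists [set v : prob_on X | C (\int[v]_(x in X) f x)%R] => //.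
exists [set g : prod_topology (fun _ : set_type (Cb X) => R) | C (g (SigSub (mem_set Cf)))] => //.
rewrite openE => g Cg; rewrite /interior /=.
have /cvg_sup/(_ (SigSub (mem_set Cf))) h : nbhs g --> g by exact: cvg_id.
apply: h; exists [set g' : prod_topology (fun _ : set_type (Cb X) => R) |
  C (g' (SigSub (mem_set Cf)))]; split => //.
by exists C.
Qed.

End weak_topology_prob.

Section bounded_parts.
Variables (R : realType) (X : set R) (mX : measurable (X : set (measurableTypeR R))).

Lemma Cb_bound (f : R -> R) : Cb X f ->
  exists2 M : R, 0 < M & forall x, (abs_part X f x <= M%:E)%E.
Proof.
move=> [_ /pinfty_ex_gt0[M M0 fM]]; exists M => // x.
rewrite /abs_part /off0 lee_fin; case: ifPn => [/set_mem Xx|_]; first exact: fM.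
by rewrite normr0 ltW.
Qed.

Lemma Cb_measurable (f : R -> R) : Cb X f ->
  measurable_fun (X : set (measurableTypeR R)) f.
Proof. by move=> [cf _]; exact: subspace_continuous_measurable_fun. Qed.

Lemma segment_mean_le (a z M : R) (h : R -> \bar R) :
  measurable_fun (setT : set R) h -> (forall x, 0 <= h x <= M%:E)%E ->
  (segment_mean a h z <= M%:E)%E.
Proof.
move=> mh hM; rewrite /segment_mean; case: eqP => [_|/eqP za].
  by case/andP: (hM a).
apply: (@le_trans _ _ ((`|z - a|^-1)%:E * (M * `|z - a|)%:E)%E).
  by apply: lee_wpmul2l; [rewrite lee_fin invr_ge0|exact: le_integral_segment].
by rewrite -EFinM mulrCA mulVf ?mulr1// normr_eq0 subr_eq0.
Qed.

Variables (f : R -> R) (M : R).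
Hypotheses (mf : measurable_fun (X : set (measurableTypeR R)) f)
  (fM : forall x, (abs_part X f x <= M%:E)%E).

Lemma pos_part_bound x : (0 <= pos_part X f x <= M%:E)%E.
Proof. by rewrite pos_part_ge0 (le_trans (pos_part_le X f x)). Qed.

Lemma neg_part_bound x : (0 <= neg_part X f x <= M%:E)%E.
Proof. by rewrite neg_part_ge0 (le_trans (neg_part_le X f x)). Qed.

Lemma integral_bounded_fin (m : probability (measurableTypeR R) R) (h : R -> \bar R) :
  measurable_fun (setT : set R) h -> (forall x, 0 <= h x <= M%:E)%E ->
  (0 <= \int[m]_x h x <= M%:E)%E.
Proof.
move=> mh hM; apply/andP; split.
  by apply: integral_ge0 => x _; case/andP: (hM x).
apply: (@le_trans _ _ (\int[m]_x M%:E)%E).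
  apply: ge0_le_integral => //.
  - by move=> x _; case/andP: (hM x).
  - by move=> x _; case/andP: (hM x).
by rewrite integral_cst//= probability_setT mule1.
Qed.

Lemma integral_mixture (s : prob_on X) (a : R) (N : nat) (w z : 'I_N -> R) :
  (forall h : R -> \bar R, measurable_fun (setT : set R) h -> (forall x, 0 <= h x)%E ->
    (\int[s]_x h x = \sum_j (w j)%:E * segment_mean a h (z j))%E) ->
  (\int[s]_(x in X) f x)%R = \sum_j w j * segment_mean_part X a f (z j).
Proof.
move=> sE.
have part (h : R -> \bar R) : measurable_fun (setT : set R) h ->
    (forall x, 0 <= h x <= M%:E)%E ->
    (\int[s]_x h x = (\sum_j w j * fine (segment_mean a h (z j)))%:E)%E.
  move=> mh hM; rewrite sE//; last by move=> x; case/andP: (hM x).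
  rewrite -sumEFin; apply: eq_bigr => j _; rewrite EFinM fineK//.
  rewrite ge0_fin_numE; last by apply: segment_mean_ge0 => x; case/andP: (hM x).
  by apply: le_lt_trans (segment_mean_le _ _ mh hM) _; rewrite ltry.
rewrite /Rintegral integral_parts.
rewrite (part _ (measurable_pos_part mX mf) pos_part_bound).
rewrite (part _ (measurable_neg_part mX mf) neg_part_bound).
rewrite -EFinB/= -sumrB; apply: eq_bigr => j _.
by rewrite -mulrBr.
Qed.

Lemma segment_mean_part_continuous (a z e : R) : z != a -> 0 < e ->
  exists2 del, 0 < del & forall z', `|z' - z| < del ->
    `|segment_mean_part X a f z' - segment_mean_part X a f z| < e.
Proof.
move=> za e0; have e2 : 0 < e / 2 by rewrite divr_gt0.
have [d1 d10 h1] := segment_mean_continuous (measurable_pos_part mX mf) pos_part_bound za e2.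
have [d2 d20 h2] := segment_mean_continuous (measurable_neg_part mX mf) neg_part_bound za e2.
exists (Num.min d1 d2); first by rewrite lt_min d10.
move=> z'; rewrite lt_min => /andP[/h1 H1 /h2 H2]; rewrite /segment_mean_part.
rewrite (_ : _ - _ - _ = (fine (segment_mean a (pos_part X f) z') -
  fine (segment_mean a (pos_part X f) z)) - (fine (segment_mean a (neg_part X f) z') -
  fine (segment_mean a (neg_part X f) z))); last by ring.
by rewrite (le_lt_trans (ler_normB _ _))// [ltRHS]splitr ltrD.
Qed.

End bounded_parts.

Lemma cvg_sum_fin (R : realType) (T : Type) (F : set_system T) (FF : Filter F)
    (N : nat) (g : 'I_N -> T -> R) (l : 'I_N -> R) :
  (forall j, g j @ F --> l j) -> (fun t => \sum_j g j t) @ F --> \sum_j l j.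
Proof.
move=> gl; elim: (index_enum 'I_N) => [|j s IH].
  by rewrite big_nil; under eq_fun => t do rewrite big_nil; exact: cvg_cst.
by rewrite big_cons; under eq_fun => t do rewrite big_cons; exact: cvgD.
Qed.

(* No countable base of the weak topology is needed: [G] is continuous in finitely
   many real parameters, once the indicator of [z j t == a] is one of them (which
   isolates the value [a]), and rational boxes of parameters do the rest. *)
Lemma measurable_weak_map (R : realType) (X : set R) (a : R) (D : set (prob_on X))
    (s0 : set_type D) d (T : measurableType d) (N : nat) (w z : 'I_N -> T -> R)
    (A : set T) (G : T -> borel s0) :
  measurable (X : set (measurableTypeR R)) -> measurable A ->
  (forall j, measurable_fun setT (w j)) ->
  (forall j, measurable_fun setT (z j : T -> measurableTypeR R)) ->
  (forall t, A t -> forall h : R -> \bar R, measurable_fun (setT : set R) h ->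
    (forall x, 0 <= h x)%E ->
    (\int[(set_val (G t : set_type D) : prob_on X)]_x h x =
     \sum_j (w j t)%:E * segment_mean a h (z j t))%E) ->
  (forall t, ~ A t -> G t = s0) ->
  measurable_fun setT G.
Proof.
move=> mX mA mw mz GE Gs0.
apply: (@measurability _ _ T (borel s0) setT G (@open (based s0)) erefl).
move=> _ [U oU <-]; rewrite setTI.
pose p (k : option ('I_N * option bool)) t : R :=
  match k with
  | None => (t \in A)%:R
  | Some (j, None) => w j t
  | Some (j, Some true) => z j t
  | Some (j, Some false) => (z j t == a)%:R
  end.
have mbool (b : T -> bool) : measurable_fun setT b ->
    measurable_fun setT (fun t => (b t)%:R : R).
  move=> mb; rewrite (_ : (fun t => _) = (fun t => if b t then 1 else 0)).
    by apply: measurable_fun_ifT => //; exact: measurable_cst.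
  by apply/funext => t; case: (b t).
have mp k : measurable_fun setT (p k).
  case: k => [[j [[]|]]|] /=.
  - exact: mz.
  - by apply: mbool; apply: measurable_fun_eqr => //; exact: mz.
  - exact: mw.
  - by apply: mbool; exact: measurable_fun_in_set.
(* Indicators that differ by less than 1 agree, so a small box never changes a boolean parameter. *)
have boolE (b b' : bool) : `|b%:R - b'%:R : R| < 1 -> b = b'.
  by case: b; case: b' => //; rewrite ?subr0 ?sub0r ?normrN normr1 ltxx.
apply: (measurable_of_box mp) => t /= UGt.
have [At|At] := pselect (A t); last first.
  exists 1 => // t' h; rewrite Gs0; first by rewrite -(Gs0 t At).
  by move=> At'; apply: At; have := boolE _ _ (h None); rewrite mem_set// => /esym/set_mem.
(* These boxes act as the neighbourhoods of [t]: they generate the filter along which the integrals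
   are shown to converge. *)
pose B e := [set t' | forall k, `|p k t' - p k t| < e].
pose F := filter_from [set e : R | 0 < e] B.
have FF : Filter F.
  apply: filter_from_filter; first by exists 1 => /=.
  move=> e e' /= e0 e0'; exists (Num.min e e'); first by rewrite /= lt_min e0.
  by move=> t' h; split => k; apply: (lt_le_trans (h k)); rewrite ge_min lexx ?orbT.
have pF k : p k @ F --> p k t.
  apply/cvgrPdist_lt => e e0; exists e => // t' h /=.
  by rewrite distrC; exact: h.
have FA : F A.
  exists 1 => //= t' h; have := boolE _ _ (h None).
  by rewrite (mem_set At) => /set_mem.
suff [e e0 h] : F (G @^-1` U) by exists e.
move: oU UGt => [U1 oU1 <-] UGt.
apply: (weak_open_near (G := fun t => set_val (G t : set_type D)) FF oU1 UGt) => f Cf.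
have [M M0 fM] := Cb_bound Cf.
have mf := Cb_measurable mX Cf.
rewrite (integral_mixture mX mf fM (GE t At)).
apply: (cvg_trans (near_eq_cvg
  (f := fun t' => \sum_j w j t' * segment_mean_part X a f (z j t')) _)).
  by apply: filterS FA => t' At'; rewrite (integral_mixture mX mf fM (GE t' At')).
apply: cvg_sum_fin => j; apply: cvgM; first exact: (pF (Some (j, None))).
apply/cvgrPdist_lt => e e0.
(* If [z j t = a], the indicator forces [z j t' = a] on the whole box, and the factor is constant
   there. *)
have [za|za] := eqVneq (z j t) a.
  exists 1 => [|t' /(_ (Some (j, Some false))) /= /boolE]; first exact: ltr01.
  by rewrite za eqxx => /eqP ->; rewrite subrr normr0.
have [del del0 h] := segment_mean_part_continuous mX mf fM za e0.
by exists del => // t' /(_ (Some (j, Some true))) /= /h; rewrite distrC.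
Qed.

(** With stability under negation, this reduces the barycenter identity to nonnegative functions. *)
Lemma Cb_max0 (R : realType) (X : set R) (f : R -> R) :
  Cb X f -> Cb X (fun x => Num.max (f x) 0).
Proof.
move=> [cf bf]; split.
  move=> x; apply: (@continuous_max _ _ (f : subspace X -> R^o) (cst 0)); first exact: cf.
  exact: cvg_cst.
move: bf => [M [Mr fM]]; exists M; split => // K MK x Xx.
apply: le_trans (fM K MK x Xx).
by rewrite ger0_norm ?le_max ?lexx ?orbT// ge_max ler_norm normr_ge0.
Qed.

Lemma CbN (R : realType) (X : set R) (f : R -> R) : Cb X f -> Cb X (fun x => - f x).
Proof.
move=> [cf bf]; split; first by move=> x; apply: cvgN; exact: cf.
by move: bf => [M [Mr fM]]; exists M; split => // K MK x Xx /=; rewrite normrN; exact: fM.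
Qed.

Lemma measurable_pairing (R : realType) (X : set R) (D : set (prob_on X))
    (s0 : set_type D) (f : R -> R) :
  Cb X f ->
  measurable_fun (setT : set (borel s0))
    (fun s => (\int[(set_val (s : set_type D) : prob_on X)]_(x in X) f x)%R).
Proof.
move=> Cf; apply: (measurability (@RGenOInfty.G R)) => [|/= _ [_] [r] -> <-].
  exact: RGenOInfty.measurableE.
rewrite setTI; apply: (@sub_sigma_algebra _ _ (@open (based s0))).
have oI : open (`]r, +oo[%classic : set R) by exact: interval_open.
exact: (@open_pairing R X D f _ Cf oI).
Qed.

Lemma measurable_integral_pos_part (R : realType) (X : set R) (D : set (prob_on X))
    (s0 : set_type D) (f : R -> R) :
  measurable (X : set (measurableTypeR R)) -> Cb X f ->
  measurable_fun (setT : set (borel s0))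
    (fun s => \int[(set_val (s : set_type D) : prob_on X)]_x pos_part X f x)%E.
Proof.
move=> mX Cf; have := @measurable_pairing R X D s0 _ (Cb_max0 Cf).
move=> /measurable_EFinP; congr (measurable_fun _ _); apply/funext => s /=.
have [M M0 fM] := Cb_bound Cf; have mf := Cb_measurable mX Cf.
have posE : (\int[(set_val (s : set_type D) : prob_on X)]_(x in X) (Num.max (f x) 0)%:E =
    \int[(set_val (s : set_type D) : prob_on X)]_x pos_part X f x)%E.
  rewrite integral_mkcond; apply: eq_integral => x _.
  by rewrite patchE /pos_part /off0; case: ifP => //; rewrite maxxx.
rewrite /Rintegral posE fineK//.
have /andP[h0 hM] := integral_bounded_fin (set_val (s : set_type D) : prob_on X)
  (measurable_pos_part mX mf) (pos_part_bound fM).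
by rewrite ge0_fin_numE// (le_lt_trans hM)// ltry.
Qed.

Lemma neg_part_pos_part (R : realType) (X : set R) (f : R -> R) :
  neg_part X f = pos_part X (fun x => - f x).
Proof.
apply/funext => x; rewrite /neg_part /pos_part /off0.
by case: ifP; rewrite ?oppr0.
Qed.

(** * Normalisation and construction of the representing measure *)

Theorem theorem2p2 (R : realType) (X : set R) (a : R) (n : nat)
    (phi : 'I_n -> R -> R) (itvX : is_interval X) (aX : X a)
    (mphi : forall i : 'I_n, measurable_fun X (phi i))
    (mu : prob_on X) (Amu : admissible a phi mu) :
  exists (s0 : set_type (@Delta R X a n phi)) (nu : probability (borel s0) R),
    is_barycenter nu mu.
Proof.
have mX : measurable (X : set (measurableTypeR R)) by exact: is_interval_measurable.
have [d [T [Q [I [w [z [cwz Xz zab wpsi wE]]]]]]] :=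
  constrained_decomposition itvX aX mphi Amu.
have mw p := let: And3 h _ _ := cwz p in h.
have w0 p := let: And3 _ h _ := cwz p in h.
have mz p := let: And3 _ _ h := cwz p in h.
pose W p t := \sum_j w p j t.
have mW p : measurable_fun setT (W p) by apply: measurable_sum => j; exact: mw.
have W0 p t : 0 <= W p t by apply: sumr_ge0 => j _; exact: w0.
have atomsW p t (h : R -> \bar R) : W p t = 0 ->
    @atoms_integral _ _ _ (measurableTypeR R) R _ (w p) (z p) h t = 0%E.
  move=> Wt; rewrite /atoms_integral big1// => j _.
  by rewrite (psumr_eq0P (fun j _ => w0 p j t) Wt)// mul0e.
have massW : (\sum_p \int[Q]_t (W p t)%:E = 1)%E.
  have m1 : measurable_fun (setT : set R) (fun x : R => (\1_(setT : set R) x)%:E : \bar R).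
    by apply/measurable_EFinP; exact: measurable_indic.
  have p1 (x : R) : (0 <= (\1_(setT : set R) x)%:E :> \bar R)%E by rewrite lee_fin.
  transitivity (\int[mu]_x (\1_(setT : set R) x)%:E)%E; last first.
    rewrite integral_indic// setIT.
    exact: (probability_setT (mu : probability (measurableTypeR R) R)).
  rewrite (wE _ m1 p1); apply: eq_bigr => p _; apply: eq_integral => t _.
  rewrite /atoms_integral /W -sumEFin; apply: eq_bigr => j _.
  by rewrite segment_mean_indic// mule1.
(* The constraints are homogeneous in the weights, so dividing by the positive mass [W p t]
   preserves them. *)
have mix p t : 0 < W p t -> exists v : prob_on X, Delta a phi v /\
    forall h : R -> \bar R, measurable_fun (setT : set R) h -> (forall x, 0 <= h x)%E ->
      (\int[v]_x h x = \sum_j (w p j t / W p t)%:E * segment_mean a h (z p j t))%E.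
  move=> Wt; apply: exists_mixture_Delta => //.
  - by move=> j; rewrite divr_ge0//; exact: w0.
  - by rewrite -mulr_suml divff// gt_eqF.
  - move=> i; under eq_bigr => j _ do rewrite mulrAC.
    by rewrite -mulr_suml mulr_le0_ge0 ?invr_ge0 ?(ltW Wt).
(* The total mass is 1, so some mass is positive; the resulting element of [Delta] is the base point
   [s0] and the value of [G] at parameters of mass zero. *)
have [p0 [t0 Wt0]] : exists p t, 0 < W p t.
  apply: contrapT => noW; have := massW; rewrite big1 => [/esym/eqP|p _].
    by rewrite onee_eq0.
  rewrite integral0_eq// => t _; congr EFin; apply/le_anti; rewrite W0 andbT leNgt.
  by apply/negP => Wt; apply: noW; exists p, t.
have [v0 [Dv0 _]] := mix p0 t0 Wt0.
pose s0 : set_type (@Delta R X a n phi) := SigSub (mem_set Dv0).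
have GP (pt : I * T) : exists s : borel s0,
    (0 < W pt.1 pt.2 -> forall h : R -> \bar R, measurable_fun (setT : set R) h ->
      (forall x, 0 <= h x)%E ->
      (\int[(set_val (s : set_type (@Delta R X a n phi)) : prob_on X)]_x h x =
       \sum_j (w pt.1 j pt.2 / W pt.1 pt.2)%:E * segment_mean a h (z pt.1 j pt.2))%E) /\
    (~ 0 < W pt.1 pt.2 -> s = s0).
  have [Wt|Wt] := pselect (0 < W pt.1 pt.2); last by exists s0.
  by have [v [Dv vE]] := mix _ _ Wt; exists (SigSub (mem_set Dv)).
have [G0 G0P] := choice GP; pose G p t := G0 (p, t).
have mG p : measurable_fun setT (G p).
  apply: (@measurable_weak_map R X a _ s0 _ T _ (fun j t => w p j t / W p t) (z p)
    [set t | 0 < W p t]) => //.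
  - apply: measurable_fun_bool_set; apply: measurable_fun_ltr => //.
  - move=> j; apply: measurable_funM; first exact: mw.
    exact: measurable_fun_invr.
  - by move=> t /(G0P (p, t)).1.
  - by move=> t /(G0P (p, t)).2.
(* The masses [W p], divided out of the atoms, return here as the density of the parameter law. *)
have [m mE] := weighted_pushforward Q mW W0 mG.
have mT : m setT = 1%E.
  have := mE (cst 1%E) (@measurable_cst _ _ _ _ _ _) (fun=> lee01).
  rewrite integral_cst// mul1e => ->; rewrite -[RHS]massW.
  by apply: eq_bigr => p _; apply: eq_integral => t _; rewrite mule1.
have [nu nuE] := probability_of_measure mT.
exists s0, nu => f Cf.
(* The identities for [m] and [mu] speak of nonnegative functions. The negative part of [f] is the
   positive part of [- f], so this one statement covers both, and boundedness then allows the
   subtraction. *)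
have part (g : R -> R) : Cb X g ->
    (\int[nu]_s \int[(set_val (s : set_type (@Delta R X a n phi)) : prob_on X)]_x
      pos_part X g x = \int[mu]_x pos_part X g x)%E.
  move=> Cg; have mg := Cb_measurable mX Cg.
  have mp := measurable_pos_part mX mg.
  rewrite nuE (mE _ (@measurable_integral_pos_part R X _ s0 g mX Cg)); last first.
    by move=> s; apply: integral_ge0 => x _; exact: pos_part_ge0.
  rewrite (wE _ mp (pos_part_ge0 _ _)); apply: eq_bigr => p _; apply: eq_integral => t _.
  have [Wt|Wt] := ltP 0 (W p t); last first.
    have {}Wt : W p t = 0 by apply/le_anti; rewrite Wt W0.
    by rewrite atomsW// Wt mul0e.
  rewrite ((G0P (p, t)).1 Wt _ mp (pos_part_ge0 _ _)) /atoms_integral/=.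
  rewrite ge0_sume_distrr => [|j _]; last first.
    rewrite mule_ge0 ?lee_fin ?divr_ge0 ?w0//.
    by apply: segment_mean_ge0; exact: pos_part_ge0.
  by apply: eq_bigr => j _; rewrite muleA -EFinM mulrC divfK ?gt_eqF.
have int_part (g : R -> R) : Cb X g -> nu.-integrable setT (fun s : borel s0 =>
    \int[(set_val (s : set_type (@Delta R X a n phi)) : prob_on X)]_x pos_part X g x)%E.
  move=> Cg; have mg := Cb_measurable mX Cg; have [M M0 gM] := Cb_bound Cg.
  apply/integrableP; split; first exact: measurable_integral_pos_part.
  under eq_integral => s _.
    rewrite gee0_abs; last by apply: integral_ge0 => x _; exact: pos_part_ge0.
    over.
  rewrite (part g Cg).
  have /andP[_ h] := integral_bounded_fin mu (measurable_pos_part mX mg) (pos_part_bound gM).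
  by apply: le_lt_trans h _; rewrite ltry.
rewrite integral_parts neg_part_pos_part -(part f Cf) -(part _ (CbN Cf)).
rewrite -(integralB measurableT (int_part f Cf) (int_part _ (CbN Cf))).
by apply: eq_integral => s _; rewrite [RHS]integral_parts neg_part_pos_part.
Qed.
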